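(* Let $e_1,e_2,e_3\in\mathbb{Z}$ be three distinct integers, $\mathbf{e}=(e_1,e_2,e_3)$, and let $Q\in\mathbb{Z}[u,v]$ be a non-degenerate binary quadratic form. Let $V_{\mathbf{e},Q}\subset\mathbb{P}(3,2,1,1)$ be the surface defined by $$y^2=(x-e_1Q(u,v))(x-e_2Q(u,v))(x-e_3Q(u,v)),$$ and let $U_{\mathbf{e},Q}$ be the open subset obtained by removing from $V_{\mathbf{e},Q}$ the subsets $\{y=0\}$ and $\{Q(u,v)=0\}$. Then for every fixed $\varepsilon>0$ there is a constant $C=C(\varepsilon,\mathbf{e},Q)$ such that for all $B\geq 1$, $$N_{U_{\mathbf{e},Q},H}(B)\leq C\,B^{1+\varepsilon}.$$
   Context: Coordinates on the weighted projective space $\mathbb{P}(3,2,1,1)$ are $(y:x:u:v)$. Every $\mathbf{x}\in\mathbb{P}(3,2,1,1)(\mathbb{Q})$ can be represented by integers $y,x,u,v$ such that for every prime $p$, either $p\nmid u$ or $p\nmid v$ or $p^2\nmid x$ or $p^3\nmid y$; with such a representative, the height is $H(\mathbf{x})=\max\{|y|^{1/3},|x|^{1/2},|u|,|v|\}$. For a subset $U$ of the surface, $N_{U,H}(B)=\#\{\mathbf{x}\in U(\mathbb{Q}): H(\mathbf{x})\leq B\}$. *)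

(* Defs.v *)
From HB Require Export structures.
From mathcomp Require Export all_boot all_order all_algebra.
From mathcomp Require Import zify ring.
From mathcomp Require Export all_classical all_reals all_analysis.

Set Implicit Arguments.
Unset Strict Implicit.
Unset Printing Implicit Defensive.

Import Order.TTheory GRing.Theory Num.Theory.
Local Open Scope classical_set_scope.
Local Open Scope quotient_scope.
Local Open Scope ring_scope.

(* A quadruple (y, x, u, v) carries the weights (3, 2, 1, 1). *)
Definition quad (T : Type) : Type := (T * T * T * T)%type.

Definition wscale (l : rat) (t : quad rat) : quad rat :=
  let: (y, x, u, v) := t in (l ^+ 3 * y, l ^+ 2 * x, l * u, l * v).

Definition cone := {t : quad rat | t != (0, 0, 0, 0)}.

Definition wequiv (s t : cone) : bool :=
  `[< exists2 l : rat, l != 0 & val t = wscale l (val s) >].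

Lemma wscale1 t : wscale 1 t = t.
Proof. by case: t => [[[y x] u] v]; rewrite /= !expr1n !mul1r. Qed.

Lemma wscaleM l m t : wscale l (wscale m t) = wscale (l * m) t.
Proof. by case: t => [[[y x] u] v]; rewrite /= !exprMn !mulrA. Qed.

Lemma wequiv_refl : reflexive wequiv.
Proof. by move=> s; apply/asboolP; exists 1; rewrite ?oner_eq0 ?wscale1. Qed.

Lemma wequiv_sym : symmetric wequiv.
Proof.
suff H s t : wequiv s t -> wequiv t s by move=> s t; apply/idP/idP; apply: H.
move=> /asboolP[l l0 e]; apply/asboolP; exists l^-1; first by rewrite invr_eq0.
by rewrite e wscaleM mulVf // wscale1.
Qed.

Lemma wequiv_trans : transitive wequiv.
Proof.
move=> t s r /asboolP[l l0 e] /asboolP[m m0 e']; apply/asboolP.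
by exists (m * l); [rewrite mulf_neq0 | rewrite e' e wscaleM].
Qed.

Canonical wequiv_equiv := EquivRel wequiv wequiv_refl wequiv_sym wequiv_trans.

(* The rational points of P(3,2,1,1): nonzero rational quadruples modulo the
   action of nonzero rationals. *)
Definition wproj := {eq_quot wequiv}.

Definition quad_ratr (t : quad int) : quad rat :=
  let: (y, x, u, v) := t in (y%:~R, x%:~R, u%:~R, v%:~R).

Definition primitive (t : quad int) : Prop :=
  let: (y, x, u, v) := t in
  forall p : nat, prime p ->
    [\/ ~~ (p%:Z %| u)%Z, ~~ (p%:Z %| v)%Z,
        ~~ (p%:Z ^+ 2 %| x)%Z | ~~ (p%:Z ^+ 3 %| y)%Z].

Definition primitive_rep (P : wproj) (t : quad int) : Prop :=
  primitive t /\ exists2 s : cone, val s = quad_ratr t & \pi_wproj s = P.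

Definition quad_height (R : realType) (t : quad int) : R :=
  let: (y, x, u, v) := t in
  Num.max (Num.max (`|y%:~R| `^ (3%:R^-1)) (`|x%:~R| `^ (2%:R^-1)))
          (Num.max `|u%:~R| `|v%:~R|).

(* The selected value exists and is unique: [primitive_repP], [heightE]. *)
Definition height (R : realType) (P : wproj) : R :=
  xget 0 [set quad_height R t | t in primitive_rep P].

Lemma dvdz_denq_pow (p n : nat) (l : rat) (z z' : int) : prime p ->
  (p%:Z %| denq l)%Z -> z'%:~R = l ^+ n * z%:~R :> rat -> (p%:Z ^+ n %| z)%Z.
Proof.
move=> pp pd e.
have E : numq l ^+ n * z = denq l ^+ n * z'.
  apply: (@intr_inj rat); rewrite !rmorphM !rmorphXn /= e mulrA -exprMn.
  by rewrite numqE [_ * l]mulrC.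
have cop : coprimez (p%:Z ^+ n) (numq l ^+ n).
  apply/coprimezXl/coprimezXr; rewrite coprimezE /= prime_coprime //.
  apply/negP => pn; have := dvdn_gcd p `|numq l|%N `|denq l|%N.
  have := pd; rewrite dvdzE /= pn (eqP (coprime_num_den l)) dvdn1 => ->.
  by move=> /eqP p1; rewrite p1 in pp.
by rewrite -(Gauss_dvdzr _ cop) E dvdz_mulr // dvdz_exp2r.
Qed.

Lemma primitive_denq (t t' : quad int) (l : rat) : primitive t ->
  quad_ratr t' = wscale l (quad_ratr t) -> denq l = 1.
Proof.
case: t t' => [[[y x] u] v] [[[y' x'] u'] v'] prim [ey ex eu ev].
apply/eqP/negPn/negP => d1.
have pp : prime (pdiv `|denq l|%N).
  rewrite pdiv_prime // ltn_neqAle eq_sym absz_gt0 denq_neq0 andbT.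
  by apply: contraNneq d1 => e; rewrite -absz_denq e.
have pd : ((pdiv `|denq l|%N)%:Z %| denq l)%Z by rewrite dvdzE /= pdiv_dvd.
have := prim _ pp.
rewrite (dvdz_denq_pow (n := 3) pp pd ey) (dvdz_denq_pow (n := 2) pp pd ex).
by rewrite (dvdz_denq_pow (n := 1) pp pd eu) (dvdz_denq_pow (n := 1) pp pd ev);
   case.
Qed.

Lemma quad_height_uniq (R : realType) (P : wproj) (t t' : quad int) :
  primitive_rep P t -> primitive_rep P t' -> quad_height R t = quad_height R t'.
Proof.
move=> [pt [s es <-]] [pt' [s' es' /esym /eqmodP /asboolP [l l0]]].
rewrite es es' => e.
have e' : quad_ratr t = wscale l^-1 (quad_ratr t').
  by rewrite e wscaleM mulVf // wscale1.
have d1 := primitive_denq pt e; have d1' := primitive_denq pt' e'.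
have lE : l = (numq l)%:~R by rewrite -[LHS]divq_num_den d1 divr1.
have lE' : l^-1 = (numq l^-1)%:~R by rewrite -[LHS]divq_num_den d1' divr1.
have nl : `|l| = 1.
  have : numq l * numq l^-1 = 1.
    by apply: (@intr_inj rat); rewrite rmorphM /= -lE -lE' mulfV.
  move=> /(congr1 absz); rewrite abszM => /eqP; rewrite muln_eq1 => /andP[/eqP h _].
  by rewrite lE -intr_norm -abszE h.
have key (n : nat) (a a' : int) : a'%:~R = l ^+ n * a%:~R :> rat -> `|a| = `|a'|.
  move=> /(congr1 Num.norm); rewrite normrM normrX nl expr1n mul1r -!intr_norm.
  by move/(@intr_inj rat).
case: t t' {pt pt' es es' e' d1 d1'} e => [[[y x] u] v] [[[y' x'] u'] v'].
move=> [ey ex eu ev].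
rewrite /quad_height -!intr_norm (key 3 _ _ ey) (key 2 _ _ ex).
by rewrite (key 1%N _ _ eu) (key 1%N _ _ ev).
Qed.

Lemma wscale_eq0 (l : rat) (t : quad rat) : l != 0 ->
  (wscale l t == (0, 0, 0, 0)) = (t == (0, 0, 0, 0)).
Proof.
move=> l0; case: t => [[[y x] u] v]; rewrite /= !xpair_eqE !mulf_eq0.
by rewrite /= (negbTE l0).
Qed.

Lemma integral_rep (P : wproj) : exists t : quad int,
  exists2 s : cone, val s = quad_ratr t & \pi_wproj s = P.
Proof.
elim/quotW: P => -[[[[y x] u] v] s0].
pose d := denq y * denq x * denq u * denq v.
have d0 : d%:~R != 0 :> rat by rewrite intr_eq0 !mulf_neq0 ?denq_neq0.
have key (z : rat) m : (denq z)%:~R * m * z = (numq z)%:~R * m.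
  by rewrite numqE; ring.
exists (numq y * (d ^+ 2 * denq x * denq u * denq v),
        numq x * (d * denq y * denq u * denq v),
        numq u * (denq y * denq x * denq v),
        numq v * (denq y * denq x * denq u)).
have s0' : wscale d%:~R (y, x, u, v) != (0, 0, 0, 0) by rewrite wscale_eq0.
exists (exist (fun t : quad rat => t != (0, 0, 0, 0)) _ s0').
  rewrite /= !rmorphM /= -!key.
  by congr (_, _, _, _); ring.
by apply/eqmodP; rewrite /= wequiv_sym; apply/asboolP; exists d%:~R.
Qed.

Lemma ltn_add4 (a b c d a' b' c' d' : nat) :
  (a <= a' -> b <= b' -> c <= c' -> d <= d' ->
   [|| a < a', b < b', c < c' | d < d'] ->
   a + b + c + d < a' + b' + c' + d')%N.
Proof. by move=> ? ? ? ? /or4P[] ?; lia. Qed.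

Lemma primitive_repP (P : wproj) : exists t, primitive_rep P t.
Proof.
have [t H] := integral_rep P.
pose sz (t : quad int) :=
  let: (y, x, u, v) := t in (`|y| + `|x| + `|u| + `|v|)%N.
have [n] := ubnP (sz t); elim: n t H => // n IH t H /ltnSE le_tn.
have [pt|] := pselect (primitive t); first by exists t.
case: t H le_tn => [[[y x] u] v] [s es sP] le_tn np.
have [p pp [pu pv px py]] : exists2 p : nat, prime p &
    [/\ (p%:Z %| u)%Z, (p%:Z %| v)%Z, (p%:Z ^+ 2 %| x)%Z & (p%:Z ^+ 3 %| y)%Z].
  apply: contrapT => H; apply: np => p pp.
  have [h|h] := boolP (p%:Z %| u)%Z; last by constructor 1.
  have [h1|h1] := boolP (p%:Z %| v)%Z; last by constructor 2.
  have [h2|h2] := boolP (p%:Z ^+ 2 %| x)%Z; last by constructor 3.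
  have [h3|h3] := boolP (p%:Z ^+ 3 %| y)%Z; last by constructor 4.
  by case: H; exists p.
move: pu pv px py => /dvdzP[u' eu] /dvdzP[v' ev] /dvdzP[x' ex] /dvdzP[y' ey].
subst; set t' := (y', x', u', v').
have p0 : p%:~R != 0 :> rat by rewrite intr_eq0 -lt0n prime_gt0.
have e' : val s = wscale p%:~R (quad_ratr t').
  by rewrite es /= !rmorphM /=; congr (_, _, _, _); rewrite mulrC.
have s0' : quad_ratr t' != (0, 0, 0, 0).
  by rewrite -(wscale_eq0 _ p0) -e' (valP s).
apply: (IH t').
  exists (exist (fun t : quad rat => t != (0, 0, 0, 0)) _ s0') => //.
  by apply/eqmodP/asboolP; exists p%:~R.
apply: leq_trans le_tn.
have pg := prime_gt1 pp.
have lt_pow k (z : int) : (`|z| <= absz (z * p%:Z ^+ k)%R)%N.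
  by rewrite abszM abszX leq_pmulr // expn_gt0 prime_gt0.
have lt_pow' k (z : int) : z != 0 -> (`|z| < absz (z * p%:Z ^+ k.+1)%R)%N.
  move=> z0; rewrite abszM abszX ltn_Pmulr ?absz_gt0 //.
  by rewrite -(exp1n k.+1) ltn_exp2r.
have := lt_pow 3 y'; have := lt_pow 2 x'.
have := lt_pow 1%N u'; have := lt_pow 1%N v'.
have := @lt_pow' 2 y'; have := @lt_pow' 1%N x'.
have := @lt_pow' 0%N u'; have := @lt_pow' 0%N v'; rewrite !expr1 /=.
move=> hv hu hx hy kv ku kx ky.
have : [|| y' != 0, x' != 0, u' != 0 | v' != 0].
  by move: s0'; rewrite /= !xpair_eqE !intr_eq0 !negb_and -!orbA.
move=> nz; apply: ltn_add4 => //; apply/or4P.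
by case/or4P: nz => [/hy|/hx|/hu|/hv] h; [constructor 1 | constructor 2
  | constructor 3 | constructor 4].
Qed.

Lemma heightE (R : realType) (P : wproj) (t : quad int) :
  primitive_rep P t -> height R P = quad_height R t.
Proof.
move=> Pt.
have : [set quad_height R t | t in primitive_rep P] (height R P).
  by apply: (@xgetI R 0 _ (quad_height R t)); exists t.
by move=> [t' Pt' <-]; apply: quad_height_uniq Pt' Pt.
Qed.

(* The count is +oo when the set is infinite, so that a finite upper bound on
   it includes finiteness. *)
Definition counting_function (R : realType) (U : set wproj) (B : R) : \bar R :=
  counting [set P : wproj | U P /\ height R P <= B].

Record binary_form := BinaryForm { bf_uu : int; bf_uv : int; bf_vv : int }.

Definition bf_eval (Q : binary_form) (w : rat * rat) : rat :=
  (bf_uu Q)%:~R * w.1 ^+ 2 + (bf_uv Q)%:~R * (w.1 * w.2)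
    + (bf_vv Q)%:~R * w.2 ^+ 2.

Definition bf_polar (Q : binary_form) (w w' : rat * rat) : rat :=
  bf_eval Q (w + w') - bf_eval Q w - bf_eval Q w'.

Definition nondegenerate_form (Q : binary_form) : Prop :=
  forall w, (forall w', bf_polar Q w w' = 0) -> w = 0.

(* Meant for weighted homogeneous [F], for which the choice of the
   representative [repr P] is immaterial. *)
Definition vanishing_locus (F : quad rat -> rat) : set wproj :=
  [set P : wproj | F (val (repr P)) = 0].

Definition surfaceV (e1 e2 e3 : int) (Q : binary_form) : set wproj :=
  vanishing_locus (fun '(y, x, u, v) =>
    y ^+ 2 - (x - e1%:~R * bf_eval Q (u, v)) * (x - e2%:~R * bf_eval Q (u, v))
             * (x - e3%:~R * bf_eval Q (u, v))).

Definition openU (e1 e2 e3 : int) (Q : binary_form) : set wproj :=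
  surfaceV e1 e2 e3 Q
    `\` (vanishing_locus (fun '(y, x, u, v) => y)
         `|` vanishing_locus (fun '(y, x, u, v) => bf_eval Q (u, v))).

Lemma openU_pi (e1 e2 e3 : int) (Q : binary_form) (s : cone) :
  openU e1 e2 e3 Q (\pi_wproj s) <->
  let: (y, x, u, v) := val s in
  let q := bf_eval Q (u, v) in
  [/\ y ^+ 2 = (x - e1%:~R * q) * (x - e2%:~R * q) * (x - e3%:~R * q),
      y <> 0 & q <> 0].
Proof.
have /eqmodP/asboolP[l l0] : s = repr (\pi_wproj s) %[mod wproj].
  by rewrite reprK.
rewrite /openU /surfaceV /vanishing_locus /setD /mkset /=.
move: (repr _) => r; case: s => -[[[y x] u] v] s0 /= ->.
have -> : bf_eval Q (l * u, l * v) = l ^+ 2 * bf_eval Q (u, v).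
  by rewrite /bf_eval /=; ring.
set q := bf_eval _ _; cbv zeta.
have eq0 n (z : rat) : (l ^+ n * z = 0) <-> (z = 0).
  split=> [/eqP|->]; last by rewrite mulr0.
  by rewrite mulf_eq0 expf_eq0 (negbTE l0) andbF => /eqP.
rewrite -[X in X = 0 /\ _](_ : l ^+ 6 * (y ^+ 2 - (x - e1%:~R * q)
    * (x - e2%:~R * q) * (x - e3%:~R * q)) = _); last by ring.
split=> [[/eq0/eqP h /not_orP[h1 h2]]|[h h1 h2]].
  split; first by apply/eqP; rewrite -subr_eq0.
  - by move=> /(eq0 3%N).
  - by move=> /(eq0 2%N).
split; first by rewrite h subrr mulr0.
by move=> [/eq0|/eq0].
Qed.

(* Main.v *)
Require Import Defs.
From mathcomp Require Import zify ring lra.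
Import Order.TTheory GRing.Theory Num.Theory.
Local Open Scope ring_scope.

Set Implicit Arguments.
Unset Strict Implicit.
Unset Printing Implicit Defensive.

(** Put [q = Q(u,v)] and [g = gcd(x,q)]. The integers [(x - e_i q)/g] are pairwise
    coprime up to divisors of the [e_i - e_j], so writing them as [h_i b_i^2] with
    [h_i] squarefree gives [T^2 g = |h1 h2 h3| k^2] for a fixed [T], and
    [l1 h1 b1^2 + l2 h2 b2^2 + l3 h3 b3^2 = 0] with [l1 = e2 - e3], etc.

    Let [|h3|] be the largest of the [|h_i|] and fix [h1, h2, b3, k]. The pairs
    [(b1, b2)] solve a quadratic congruence modulo [b3^2], hence lie in few lattices of
    determinant about [b3^2]; the determinant of two pairs in the same lattice is a
    multiple [r b3^2] with [r^2 |h1 h2| << h3^2], and [r] determines the second pair in a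
    dyadic range. As [|h1 h2 h3| k^2 |h3| b3^2 << B^2], one gets
    [|h1 h2| b3 k max(1, |r|) << B], and the divisor bound leaves [B^(1+eps)] pairs
    [(x, q)]. The same lattice argument shows that [Q(u,v) = q] has [B^eps] solutions.

    All factors [B^eps] are powers of [tau M], the maximal number of divisors of an
    integer at most [M], which also bounds the number of dyadic ranges. *)

(** * Counting and the divisor bound *)

Local Close Scope ring_scope.

(** Duplicate-free lists play the role of finite subsets, so a bound also asserts finiteness and
    makes sense for undecidable predicates. *)
Definition count_le (T : eqType) (P : T -> Prop) (n : nat) : Prop :=
  forall s : seq T, uniq s -> (forall x, x \in s -> P x) -> size s <= n.

Lemma count_le_weaken (T : eqType) (P : T -> Prop) m n :
  count_le P m -> m <= n -> count_le P n.
Proof. by move=> H le s us sP; apply: leq_trans (H s us sP) le. Qed.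

Lemma count_le_seq (T : eqType) (P : T -> Prop) (l : seq T) :
  (forall x, P x -> x \in l) -> count_le P (size l).
Proof. by move=> H s us sP; apply: uniq_leq_size => // x /sP /H. Qed.

Lemma count_le_inj (T U : eqType) (P : T -> Prop) (Q : U -> Prop) (f : T -> U) n :
  (forall x, P x -> Q (f x)) ->
  (forall x x', P x -> P x' -> f x = f x' -> x = x') ->
  count_le Q n -> count_le P n.
Proof.
move=> PQ inj H s us sP; rewrite -(size_map f); apply: H.
  rewrite map_inj_in_uniq // => x x' xs xs'; apply: inj; exact: sP.
by move=> _ /mapP[x xs ->]; apply/PQ/sP.
Qed.

Lemma count_le_sub (T : eqType) (P Q : T -> Prop) n :
  (forall x, P x -> Q x) -> count_le Q n -> count_le P n.
Proof. by move=> PQ; apply: (count_le_inj (f := id)). Qed.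

Lemma count_le_or (T : eqType) (P Q : T -> Prop) m n :
  count_le P m -> count_le Q n -> count_le (fun x => P x \/ Q x) (m + n).
Proof.
move=> HP HQ s us sPQ; rewrite -(count_predC (fun x => `[< P x >]) s) -!size_filter.
apply: leq_add.
  by apply: HP; [exact: filter_uniq | move=> x; rewrite mem_filter => /andP[/asboolP]].
apply: HQ; first exact: filter_uniq.
by move=> x; rewrite mem_filter => /andP[/= /asboolP nP /sPQ[]].
Qed.

Lemma count_le_fiber (T U : eqType) (P : T -> Prop) (Q : U -> Prop) (f : T -> U) m n :
  (forall x, P x -> Q (f x)) -> count_le Q m ->
  (forall y, count_le (fun x => P x /\ f x = y) n) -> count_le P (m * n).
Proof.
move=> PQ HQ Hf s us sP.
have sE : size s = \sum_(y <- undup (map f s)) count (fun x => f x == y) s.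
  rewrite -[LHS]sum1_size.
  under [RHS]eq_bigr do rewrite -sum1_count big_mkcond.
  rewrite exchange_big /= big_seq [RHS]big_seq; apply: eq_bigr => x xs.
  rewrite -big_mkcond /= sum1_count.
  rewrite (eq_count (a2 := pred1 (f x))); last by move=> y /=; rewrite eq_sym.
  by rewrite count_uniq_mem ?undup_uniq // mem_undup map_f.
rewrite sE; apply: (@leq_trans (\sum_(y <- undup (map f s)) n)).
  apply: leq_sum => y _; rewrite -size_filter; apply: (Hf y).
    exact: filter_uniq.
  by move=> x; rewrite mem_filter => /andP[/eqP fx /sP].
rewrite big_const_seq count_predT iter_addn_0 mulnC leq_mul2r; apply/orP; right.
apply: HQ; first exact: undup_uniq.
by move=> y; rewrite mem_undup => /mapP[x xs ->]; apply/PQ/sP.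
Qed.

Lemma count_le_prod (T U : eqType) (P : T -> Prop) (Q : U -> Prop) m n :
  count_le P m -> count_le Q n -> count_le (fun z : T * U => P z.1 /\ Q z.2) (m * n).
Proof.
move=> HP HQ; apply: (count_le_fiber (f := fst) (Q := P)) => //; first by move=> x [].
move=> y; apply: (count_le_inj (f := snd) (Q := Q)) => //; first by move=> x [[]].
by move=> [a b] [a' b'] /= [_ ->] [_ ->] ->.
Qed.

(** The map [phi] may vary with the fibre of [f], as it does when it is built from a reference point
    of that fibre; choice glues these maps into the single injection [(f x, phi (f x) x)]. *)
Lemma count_le_sigma (T U V : eqType) (P : T -> Prop) (f : T -> U)
    (R : U * V -> Prop) n :
  (forall y, exists phi : T -> V,
     (forall x, P x -> f x = y -> R (y, phi x)) /\
     (forall x x', P x -> P x' -> f x = y -> f x' = y -> phi x = phi x' -> x = x')) ->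
  count_le R n -> count_le P n.
Proof.
move=> /choice[phi H].
apply: (count_le_inj (f := fun x => (f x, phi (f x) x))).
  by move=> x Px; have [h _] := H (f x); apply: h.
move=> x x' Px Px' [e]; rewrite e => e'.
by have [_ h] := H (f x'); apply: h.
Qed.

Definition tau (M : nat) : nat := \max_(n < M.+1) size (divisors n).

Lemma size_divisors_tau n M : n <= M -> size (divisors n) <= tau M.
Proof.
move=> le; rewrite -ltnS in le.
exact: (@leq_bigmax _ (fun i : 'I_M.+1 => size (divisors i)) (Ordinal le)).
Qed.

Lemma leq_tau M N : M <= N -> tau M <= tau N.
Proof.
move=> le; apply/bigmax_leqP => i _; apply: size_divisors_tau.
by apply: leq_trans le; rewrite -ltnS.
Qed.

Lemma tau_gt0 M : 0 < M -> 0 < tau M.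
Proof. by move=> M0; apply: leq_trans (size_divisors_tau M0). Qed.

(* [2 ^ l] has [l + 1] divisors. *)
Lemma log_lt_tau l M : 2 ^ l <= M -> l < tau M.
Proof.
move=> le; apply: leq_trans (size_divisors_tau le).
have -> : l.+1 = size [seq 2 ^ i | i <- iota 0 l.+1] by rewrite size_map size_iota.
apply: uniq_leq_size.
  rewrite map_inj_uniq ?iota_uniq // => i j /eqP; rewrite eqn_exp2l // => /eqP //.
move=> x /mapP[i]; rewrite mem_iota add0n ltnS => /= le_il ->.
by rewrite -dvdn_divisors ?expn_gt0 // dvdn_exp2l.
Qed.

Lemma count_le_log M : count_le (fun l => 2 ^ l <= M) (tau M).
Proof.
rewrite -(size_iota 0 (tau M)); apply: count_le_seq => l /log_lt_tau.
by rewrite mem_iota.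
Qed.

Lemma count_le_leq n : count_le (fun m => 0 < m <= n) n.
Proof.
rewrite -{2}(size_iota 1 n); apply: count_le_seq => m.
by rewrite mem_iota add1n ltnS.
Qed.

Lemma count_le_divisors n : 0 < n -> count_le (fun d => d %| n) (size (divisors n)).
Proof. by move=> n0; apply: count_le_seq => d; rewrite dvdn_divisors. Qed.

Lemma count_le_absz (P : nat -> Prop) n :
  count_le P n -> count_le (fun z : int => P `|z|%N) (n * 2).
Proof.
move=> HP; apply: (count_le_fiber (f := absz) _ HP) => // y.
have -> : 2 = size [:: Posz y; - Posz y]%R by [].
apply: count_le_seq => z [_ <-]; rewrite !inE.
by case: z => z; rewrite ?NegzE ?abszN ?eqxx ?orbT.
Qed.

(** Every divisor has the form [d' * p ^ i] with [d'] dividing [m] and [i <= e]. *)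
Lemma size_divisors_pfactor p e m : prime p -> coprime p m -> 0 < m ->
  size (divisors (m * p ^ e)) <= e.+1 * size (divisors m).
Proof.
move=> pp cpm m0; have pe0 : 0 < p ^ e by rewrite expn_gt0 prime_gt0.
have n0 : 0 < m * p ^ e by rewrite muln_gt0 m0.
rewrite -[e.+1](size_iota 0) -(size_allpairs (fun i d => d * p ^ i)).
apply: uniq_leq_size; first exact: divisors_uniq.
move=> d; rewrite -dvdn_divisors // => dn.
have d0 : 0 < d by apply: dvdn_gt0 dn.
have [d' cpd' dE] := pfactor_coprime pp d0.
apply/allpairsP; exists (logn p d, d'); split => //.
  rewrite mem_iota add0n ltnS; apply/andP; split=> //=.
  apply: leq_trans (dvdn_leq_log p n0 dn) _.
  by rewrite lognM // logn_coprime // pfactorK.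
rewrite -dvdn_divisors //.
rewrite -(@Gauss_dvdl d' m (p ^ e)) 1?coprime_sym ?coprimeXl //.
by apply: dvdn_trans dn; rewrite {1}dE dvdn_mulr.
Qed.

(** With [f = e %/ k], one has [e + 1 <= k * (f + 1) <= k * 2 ^ f]; then take [k]-th powers. *)
Lemma expnS_leq_exp2 k e : 0 < k -> e.+1 ^ k <= k ^ k * 2 ^ e.
Proof.
move=> k0; apply: (@leq_trans ((k * 2 ^ (e %/ k)) ^ k)).
  rewrite leq_exp2r //; apply: (@leq_trans (k * (e %/ k).+1)).
    by rewrite mulnC ltn_ceil.
  by rewrite leq_mul2l ltn_expl ?orbT.
by rewrite expnMn -expnM leq_mul2l leq_exp2l // leq_trunc_div orbT.
Qed.

(** The divisor bound with exponent [1 / k]. A prime [p >= 2 ^ k] costs nothing, since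
    [(e + 1) ^ k <= 2 ^ (e * k) <= p ^ e]; each of the fewer than [2 ^ k] smaller primes costs a
    factor [k ^ k]. *)
Lemma size_divisors_pow k n : 0 < k -> 0 < n ->
  size (divisors n) ^ k <= (k ^ k) ^ (2 ^ k) * n.
Proof.
move=> k0 n0.
have c0 : 0 < k ^ k by rewrite expn_gt0 k0.
(* Counting only the small primes that divide [n] gives a bound that can be proved by splitting off
   one prime power at a time. *)
suff H : size (divisors n) ^ k
    <= (k ^ k) ^ (count (fun p => p < 2 ^ k) (primes n)) * n.
  apply: leq_trans H _; rewrite leq_mul2r leq_pexp2l ?orbT //.
  rewrite -size_filter; apply: (@leq_trans (size (iota 0 (2 ^ k)))).
    2: by rewrite size_iota.
  apply: uniq_leq_size.
    by rewrite filter_uniq ?primes_uniq.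
  by move=> p; rewrite mem_filter mem_iota add0n => /andP[].
elim/ltn_ind: n n0 => n IH n0.
have [n1|n1] := leqP n 1.
  have -> : n = 1 by apply/eqP; rewrite eqn_leq n1.
  by rewrite exp1n.
have pp := pdiv_prime n1; set p := pdiv n in pp.
have pn : p %| n by exact: pdiv_dvd.
have [m cpm nE] := pfactor_coprime pp n0.
have e0 : 0 < logn p n by rewrite -pfactor_dvdn // expn1.
move: (logn p n) e0 nE => e e0 nE.
have m0 : 0 < m by move: n0; rewrite nE muln_gt0 => /andP[].
have pe1 : 1 < p ^ e by rewrite -(exp1n e) ltn_exp2r // prime_gt1.
have mn : m < n by rewrite nE ltn_Pmulr.
have cE : count (fun p => p < 2 ^ k) (primes n)
    = (p < 2 ^ k) + count (fun p => p < 2 ^ k) (primes m).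
  have /seq.permP -> : perm_eq (primes n) (p :: primes m).
    apply: uniq_perm; rewrite ?primes_uniq //=.
      rewrite primes_uniq andbT mem_primes pp m0 /=.
      by rewrite prime_coprime // in cpm.
    move=> q; rewrite nE primesM // ?expn_gt0 ?prime_gt0 //.
    by rewrite primesX // (primes_prime pp) !in_cons in_nil orbF orbC.
  by [].
have := IH m mn m0; rewrite cE expnD => {}IH.
apply: (@leq_trans ((e.+1 * size (divisors m)) ^ k)).
  by rewrite {1}nE leq_exp2r // size_divisors_pfactor.
rewrite expnMn nE.
have key : e.+1 ^ k <= (k ^ k) ^ (p < 2 ^ k) * p ^ e.
  have [pk|pk] := ltnP p (2 ^ k).
    rewrite expn1; apply: leq_trans (expnS_leq_exp2 e k0) _.
    by rewrite leq_mul2l leq_exp2r ?prime_gt1 ?orbT.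
  rewrite expn0 mul1n; apply: (@leq_trans ((2 ^ e) ^ k)).
    by rewrite leq_exp2r // ltn_expl.
  by rewrite -expnM mulnC expnM leq_exp2r.
apply: leq_trans (leq_mul key IH) _.
by apply: eq_leq; rewrite -!mulnA; congr muln; rewrite mulnCA [p ^ e * _]mulnC !mulnA.
Qed.

Lemma tau_pow k M : 0 < k -> 0 < M -> tau M ^ k <= (k ^ k) ^ (2 ^ k) * M.
Proof.
move=> k0 M0; have [i ->] : exists i : 'I_M.+1, tau M = size (divisors i).
  have [|i _ e] := @eq_bigmax_cond _ (mem 'I_M.+1) (fun i => size (divisors i)).
    by rewrite card_ord.
  by exists i.
have [->|i0] := posnP i; last first.
  apply: leq_trans (size_divisors_pow k0 i0) _.
  by rewrite leq_mul2l -ltnS ltn_ord orbT.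
(* By convention [divisors 0] is [[:: 1]], so a maximum reached at index 0 equals 1. *)
by rewrite exp1n muln_gt0 !expn_gt0 k0 M0.
Qed.

Local Open Scope ring_scope.

(** * Lattice points on a conic in a dyadic range *)

Definition det2 (P P' : nat * nat) : int :=
  P.1%:Z * P'.2%:Z - P'.1%:Z * P.2%:Z.

(** This is [det2] after the sign of [P.2] is changed, a reflection that a diagonal form does not
    see. *)
Definition codet2 (P P' : nat * nat) : int :=
  P.1%:Z * P'.2%:Z + P'.1%:Z * P.2%:Z.

(** Cancels [a] in a congruence modulo [m] at the cost of a factor [T], by writing [T] as a
    combination of [a] and [m]. *)
Lemma dvdz_gcd_mul (a m T X : int) :
  (m %| a * X)%Z -> (gcdz a m %| T)%Z -> (m %| T * X)%Z.
Proof.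
move=> ma gT.
have [u [v _ ->]] : exists u, exists2 v, True & T = u * a + v * m.
  have /dvdzP[c ->] := gT; have [u [v <-]] := Bezoutz a m.
  by exists (c * u), (c * v) => //; ring.
rewrite mulrDl rpredD //.
  by rewrite -mulrA dvdz_mull.
by rewrite mulrAC dvdz_mull.
Qed.

Lemma dvdz_coprime_pair (P : nat * nat) (e Y : int) : coprime P.1 P.2 ->
  (e %| P.1%:Z * Y)%Z -> (e %| P.2%:Z * Y)%Z -> (e %| Y)%Z.
Proof.
move=> cop e1 e2; have [u [v uv]] := Bezoutz P.1%:Z P.2%:Z.
have {uv}uv : u * P.1%:Z + v * P.2%:Z = 1 by rewrite uv /gcdz /= (eqP cop).
rewrite -[Y]mul1r -uv mulrDl rpredD // -mulrA dvdz_mull //.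
Qed.

(** Proportionality modulo [e] is transitive through a primitive [P0]: each coordinate of [P0] times
    [det2 P P'] is a combination of the two given determinants. *)
Lemma det2_dvd (e T : int) (P0 P P' : nat * nat) : coprime P0.1 P0.2 ->
  (e %| T * det2 P0 P)%Z -> (e %| T * det2 P0 P')%Z -> (e %| T * det2 P P')%Z.
Proof.
move=> cop h h'; apply: dvdz_coprime_pair cop _ _.
- have -> : P0.1%:Z * (T * det2 P P') =
      P.1%:Z * (T * det2 P0 P') - P'.1%:Z * (T * det2 P0 P) by rewrite /det2; ring.
  by rewrite rpredB // dvdz_mull.
- have -> : P0.2%:Z * (T * det2 P P') =
      P.2%:Z * (T * det2 P0 P') - P'.2%:Z * (T * det2 P0 P) by rewrite /det2; ring.
  by rewrite rpredB // dvdz_mull.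
Qed.

(** The same argument with [P0] reflected: two points proportional to the reflection of [P0] are
    proportional to each other. *)
Lemma codet2_dvd (e T : int) (P0 P P' : nat * nat) : coprime P0.1 P0.2 ->
  (e %| T * codet2 P0 P)%Z -> (e %| T * codet2 P0 P')%Z ->
  (e %| T * det2 P P')%Z.
Proof.
move=> cop h h'; apply: dvdz_coprime_pair cop _ _.
- have -> : P0.1%:Z * (T * det2 P P') =
    P.1%:Z * (T * codet2 P0 P') - P'.1%:Z * (T * codet2 P0 P)
    by rewrite /det2 /codet2; ring.
  by rewrite rpredB // dvdz_mull.
- have -> : P0.2%:Z * (T * det2 P P') =
    P'.2%:Z * (T * codet2 P0 P) - P.2%:Z * (T * codet2 P0 P')
    by rewrite /det2 /codet2; ring.
  by rewrite rpredB // dvdz_mull.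
Qed.

Definition form2 (al be : int) (P : nat * nat) : int :=
  al * P.1%:Z ^+ 2 + be * P.2%:Z ^+ 2.

Lemma form2_det (al be : int) (P P' : nat * nat) :
  al * (det2 P P' * codet2 P P') =
  P'.2%:Z ^+ 2 * form2 al be P - P.2%:Z ^+ 2 * form2 al be P'.
Proof. by rewrite /det2 /codet2 /form2; ring. Qed.

Lemma dvdz_det_codet (al be m T : int) (P P' : nat * nat) :
  (gcdz al m %| T)%Z -> (m %| form2 al be P)%Z -> (m %| form2 al be P')%Z ->
  (m %| T * (det2 P P' * codet2 P P'))%Z.
Proof.
move=> gT h h'; apply: dvdz_gcd_mul gT.
by rewrite (form2_det al be) rpredB // dvdz_mull.
Qed.

(* A quadratic congruence has few roots: the class of [P] modulo [m] is
   determined, up to the bounded factor [2 T ^ 4], by the part of [m] on which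
   [P] agrees with a reference point [P0]. *)
Lemma dvdz_det2_class (al be m T : int) (P0 P P' : nat * nat) :
  m != 0 ->
  (gcdz al m %| T)%Z -> coprime P0.1 P0.2 -> (gcdz P0.1 m %| T)%Z ->
  (m %| form2 al be P0)%Z -> (m %| form2 al be P)%Z -> (m %| form2 al be P')%Z ->
  (gcdz P.2 m %| T)%Z ->
  gcdz m (det2 P0 P) = gcdz m (det2 P0 P') ->
  (m %| 2 * T ^+ 4 * det2 P P')%Z.
Proof.
move=> m0 gal cop g1 h0 h h' g2 e.
set d := gcdz m (det2 P0 P) in e.
have d0 : d != 0 by rewrite gcdz_eq0 negb_and m0.
have dP : (d %| det2 P0 P)%Z by exact: dvdz_gcdr.
have dP' : (d %| det2 P0 P')%Z by rewrite e dvdz_gcdr.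
have dm : (d %| m)%Z by exact: dvdz_gcdl.
have [m' mE] := dvdzP dm.
(* Modulo the complementary factor [m'] the determinant has a cofactor prime to [m'], so the
   codeterminant has to absorb all of [m'], up to [T]. *)
have m'P (P1 : nat * nat) : gcdz m (det2 P0 P1) = d -> (m %| form2 al be P1)%Z ->
    (m' %| T * codet2 P0 P1)%Z.
  move=> e1 h1.
  have : (d %| det2 P0 P1)%Z by rewrite -e1 dvdz_gcdr.
  move=> /dvdzP[q qE].
  have cop' : coprimez m' q.
    have : gcdz (m' * d) (q * d) = d by rewrite -mE -qE.
    rewrite -mulz_gcdl => /eqP.
    have dn : `|d|%:Z = d by rewrite /d /gcdz.
    rewrite dn -{2}[d]mul1r (inj_eq (mulIf d0)) => /eqP h2.
    by rewrite /coprimez h2.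
  have := dvdz_det_codet gal h0 h1; rewrite mE qE.
  have -> : T * (q * d * codet2 P0 P1) = (q * (T * codet2 P0 P1)) * d by ring.
  by rewrite dvdz_mul2r // Gauss_dvdzr.
have hd : (d %| T * det2 P P')%Z.
  by apply: det2_dvd cop _ _; rewrite dvdz_mull.
have hm' : (m' %| T * det2 P P')%Z.
  by apply: codet2_dvd cop (m'P _ _ h) (m'P _ _ h').
(* The factors [d] and [m'] need not be coprime, but their gcd divides [T] times both determinant
   and codeterminant, hence their sum [2 * T * P0.1 * P.2]; the gcd hypotheses replace each
   coordinate by [T]. *)
set w := gcdz d m'.
have wm : (w %| m)%Z by rewrite mE dvdz_mull // dvdz_gcdl.
have wT : (w %| 2 * T ^+ 3)%Z.
  have w1 : (w %| P0.1%:Z * (P.2%:Z * (2 * T)))%Z.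
    have -> : P0.1%:Z * (P.2%:Z * (2 * T)) = T * det2 P0 P + T * codet2 P0 P.
      by rewrite /det2 /codet2; ring.
    rewrite rpredD //.
      by apply: dvdz_trans (dvdz_gcdl _ _) _; rewrite dvdz_mull.
    by apply: dvdz_trans (dvdz_gcdr _ _) (m'P _ _ h).
  have wg (z : int) : (gcdz z m %| T)%Z -> (gcdz z w %| T)%Z.
    move=> gz; apply: dvdz_trans gz.
    by rewrite dvdz_gcd dvdz_gcdl (dvdz_trans (dvdz_gcdr _ _) wm).
  have w2 := dvdz_gcd_mul w1 (wg _ g1).
  rewrite mulrCA in w2.
  have w3 := dvdz_gcd_mul w2 (wg _ g2).
  by apply: etrans w3; congr dvdz; ring.
(* Both [d] and [m'] divide [T * det2 P P'], so multiplying it by the other factor gives a multiple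
   of [m]; Bezout combines these into [w] times it, and [c * w = 2 * T ^ 3]. *)
have [u [v uv]] := Bezoutz d m'.
have [c cE] := dvdzP wT.
have -> : 2 * T ^+ 4 * det2 P P' = c * u * (d * (T * det2 P P'))
     + c * v * (m' * (T * det2 P P')).
  transitivity (c * (u * d + v * m') * (T * det2 P P')); last by ring.
  rewrite uv -/w -cE; ring.
rewrite rpredD //.
  by rewrite dvdz_mull // mE mulrC dvdz_mul.
by rewrite dvdz_mull // mE dvdz_mul.
Qed.

(* Dividing [form2_det] by the codeterminant, which is large in this case. *)
Lemma det2_bound_large (al be m E D : int) (P P' : nat * nat) :
  0 < D -> 0 <= m -> 0 <= E ->
  `|form2 al be P| <= m * E -> `|form2 al be P'| <= m * E ->
  D <= P.2%:Z <= 2 * D -> D <= P'.2%:Z <= 2 * D ->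
  `|be| * P.2%:Z ^+ 2 <= 2 * `|al| * P.1%:Z ^+ 2 ->
  det2 P P' ^+ 2 * `|al * be| <= 128 * (m * E) ^+ 2.
Proof.
move=> D0 m0 E0 f f' /andP[lo hi] /andP[lo' hi'] big.
have c0 : 0 <= codet2 P P' by rewrite /codet2 addr_ge0 // mulr_ge0.
have mE0 : 0 <= m * E by rewrite mulr_ge0.
have D2 : 0 <= D ^+ 2 by rewrite sqr_ge0.
have lo2 : D ^+ 2 <= P.2%:Z ^+ 2 by rewrite ler_sqr ?nnegrE // ltW.
have lo2' : D ^+ 2 <= P'.2%:Z ^+ 2 by rewrite ler_sqr ?nnegrE // ltW.
have hi2 : P.2%:Z ^+ 2 <= 4 * D ^+ 2.
  by rewrite -[4 * _]/(2 ^+ 2 * _) -exprMn ler_sqr ?nnegrE // mulr_ge0 // ltW.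
have hi2' : P'.2%:Z ^+ 2 <= 4 * D ^+ 2.
  by rewrite -[4 * _]/(2 ^+ 2 * _) -exprMn ler_sqr ?nnegrE // mulr_ge0 // ltW.
have nsq (x y : int) : `|x ^+ 2 * y| = x ^+ 2 * `|y|.
  by rewrite normrM ger0_norm ?sqr_ge0.
have s1 : `|al| * (`|det2 P P'| * codet2 P P') <= 8 * D ^+ 2 * (m * E).
  rewrite -{1}(ger0_norm c0) -!normrM (form2_det al be).
  apply: le_trans (ler_normB _ _) _; rewrite !nsq.
  have -> : 8 * D ^+ 2 * (m * E) = 4 * D ^+ 2 * (m * E) + 4 * D ^+ 2 * (m * E) by ring.
  by apply: lerD; apply: ler_pM => //; rewrite sqr_ge0.
have s2 : (`|al| * (`|det2 P P'| * codet2 P P')) ^+ 2 <= (8 * D ^+ 2 * (m * E)) ^+ 2.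
  have D0' := ltW D0.
  by rewrite ler_sqr ?nnegrE // !mulr_ge0.
(* The codeterminant is at least [P.1 * P'.2], and the hypothesis bounds [P.1] from below in terms
   of [P.2 >= D]. *)
have s3 : `|be| * (D ^+ 2) ^+ 2 <= 2 * `|al| * codet2 P P' ^+ 2.
  apply: (@le_trans _ _ (2 * `|al| * P.1%:Z ^+ 2 * P'.2%:Z ^+ 2)); last first.
    rewrite -mulrA ler_wpM2l ?mulr_ge0 // -exprMn ler_sqr ?nnegrE ?mulr_ge0 //.
    by rewrite /codet2 lerDl mulr_ge0.
  apply: (@le_trans _ _ (`|be| * P.2%:Z ^+ 2 * P'.2%:Z ^+ 2)).
    by rewrite -mulrA ler_wpM2l // [_ ^+ 2 ^+ 2]expr2 ler_pM.
  by rewrite ler_wpM2r ?sqr_ge0.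
have D4 : 0 < (D ^+ 2) ^+ 2 by rewrite !exprn_gt0.
rewrite -(ler_pM2r D4) normrM.
have s4 : `|al| * `|det2 P P'| ^+ 2 * (`|be| * (D ^+ 2) ^+ 2) <=
    `|al| * `|det2 P P'| ^+ 2 * (2 * `|al| * codet2 P P' ^+ 2).
  by apply: ler_wpM2l => //; rewrite mulr_ge0 ?sqr_ge0.
rewrite -(real_normK (num_real (det2 P P'))).
have -> : `|det2 P P'| ^+ 2 * (`|al| * `|be|) * D ^+ 2 ^+ 2 =
   `|al| * `|det2 P P'| ^+ 2 * (`|be| * (D ^+ 2) ^+ 2) by ring.
apply: le_trans s4 _.
have -> : `|al| * `|det2 P P'| ^+ 2 * (2 * `|al| * codet2 P P' ^+ 2) =
   2 * (`|al| * (`|det2 P P'| * codet2 P P')) ^+ 2 by ring.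
have -> : 128 * (m * E) ^+ 2 * D ^+ 2 ^+ 2 = 2 * (8 * D ^+ 2 * (m * E)) ^+ 2 by ring.
by rewrite ler_wpM2l.
Qed.

(** When the [be]-term dominates at both points there is no cancellation, so
    [|be| * D ^ 2 <= 2 * m * E]; the first coordinates are then small enough to bound the
    determinant directly. *)
Lemma det2_bound_small (al be m E D : int) (P P' : nat * nat) :
  0 < D -> 0 <= m -> 0 <= E ->
  `|form2 al be P| <= m * E ->
  D <= P.2%:Z <= 2 * D -> D <= P'.2%:Z <= 2 * D ->
  2 * `|al| * P.1%:Z ^+ 2 <= `|be| * P.2%:Z ^+ 2 ->
  2 * `|al| * P'.1%:Z ^+ 2 <= `|be| * P'.2%:Z ^+ 2 ->
  det2 P P' ^+ 2 * `|al * be| <= 128 * (m * E) ^+ 2.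
Proof.
move=> D0 m0 E0 f /andP[lo hi] /andP[lo' hi'] s s'.
have lo2 : D ^+ 2 <= P.2%:Z ^+ 2 by rewrite ler_sqr ?nnegrE // ltW.
have hi2 : P.2%:Z ^+ 2 <= 4 * D ^+ 2.
  by rewrite -[4 * _]/(2 ^+ 2 * _) -exprMn ler_sqr ?nnegrE // mulr_ge0 // ltW.
have hi2' : P'.2%:Z ^+ 2 <= 4 * D ^+ 2.
  by rewrite -[4 * _]/(2 ^+ 2 * _) -exprMn ler_sqr ?nnegrE // mulr_ge0 // ltW.
have t1 : `|be| * D ^+ 2 <= 2 * (m * E).
  have : `|be| * P.2%:Z ^+ 2 <= `|form2 al be P| + `|al| * P.1%:Z ^+ 2.
    have -> : `|be| * P.2%:Z ^+ 2 = `|form2 al be P - al * P.1%:Z ^+ 2|.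
      have -> : form2 al be P - al * P.1%:Z ^+ 2 = be * P.2%:Z ^+ 2.
        by rewrite /form2; ring.
      by rewrite normrM [`| _ ^+ 2|]ger0_norm ?sqr_ge0.
    apply: le_trans (ler_normB _ _) _.
    by rewrite normrM [`| _ ^+ 2|]ger0_norm ?sqr_ge0.
  have : `|be| * D ^+ 2 <= `|be| * P.2%:Z ^+ 2 by rewrite ler_wpM2l.
  lra.
have t2 : 2 * `|al| * det2 P P' ^+ 2 <= 16 * `|be| * (D ^+ 2) ^+ 2.
  (* A difference of two nonnegative numbers is at most the larger one, so only one of the two
     products in the determinant has to be bounded. *)
  have pq (x y : int) : 0 <= x -> 0 <= y -> (x - y) ^+ 2 <= x ^+ 2 \/ (x - y) ^+ 2 <= y ^+ 2.
    by move=> x0 y0; have [?|?] := lerP x y; [right | left]; nra.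
  have cross (X Y Z : int) : 0 <= Y -> 0 <= Z -> 2 * `|al| * X <= `|be| * Y ->
      0 <= X -> Y <= 4 * D ^+ 2 -> Z <= 4 * D ^+ 2 ->
      2 * `|al| * (X * Z) <= 16 * `|be| * (D ^+ 2) ^+ 2.
    move=> Y0 Z0 h X0 hY hZ; apply: (@le_trans _ _ (`|be| * Y * Z)).
      by rewrite mulrA ler_wpM2r.
    have -> : 16 * `|be| * (D ^+ 2) ^+ 2 = `|be| * ((4 * D ^+ 2) * (4 * D ^+ 2)) by ring.
    by rewrite -mulrA ler_wpM2l // ler_pM.
  have [] := pq (P.1%:Z * P'.2%:Z) (P'.1%:Z * P.2%:Z); rewrite ?mulr_ge0 // => h.
    apply: le_trans (ler_wpM2l _ h) _; first by rewrite mulr_ge0.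
    by rewrite exprMn; apply: cross s _ hi2 hi2'; rewrite sqr_ge0.
  apply: le_trans (ler_wpM2l _ h) _; first by rewrite mulr_ge0.
  by rewrite exprMn; apply: cross s' _ hi2' hi2; rewrite sqr_ge0.
have t3 : (`|be| * D ^+ 2) ^+ 2 <= (2 * (m * E)) ^+ 2.
  have D0' := ltW D0.
  by rewrite ler_sqr ?nnegrE // !mulr_ge0.
have t4 : (2 * `|al| * det2 P P' ^+ 2) * `|be| <= 16 * `|be| * (D ^+ 2) ^+ 2 * `|be|.
  by rewrite ler_wpM2r.
rewrite normrM.
have := sqr_ge0 (m * E).
set X := (m * E) in t3 *.
have e1 : (2 * `|al| * det2 P P' ^+ 2) * `|be| = 2 * (det2 P P' ^+ 2 * (`|al| * `|be|)) by ring.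
have e2 : 16 * `|be| * (D ^+ 2) ^+ 2 * `|be| = 16 * (`|be| * D ^+ 2) ^+ 2 by ring.
rewrite e1 e2 in t4; rewrite exprMn in t3.
set Y := det2 P P' ^+ 2 * _ in t4 *.
lra.
Qed.

Lemma det2C (P P' : nat * nat) : det2 P' P = - det2 P P'.
Proof. by rewrite /det2; ring. Qed.

(** Either the [al]-term is substantial at one of the points, which by antisymmetry of [det2] may be
    taken first, or the [be]-term dominates at both. *)
Lemma det2_bound (al be m E D : int) (P P' : nat * nat) :
  0 < D -> 0 <= m -> 0 <= E ->
  `|form2 al be P| <= m * E -> `|form2 al be P'| <= m * E ->
  D <= P.2%:Z <= 2 * D -> D <= P'.2%:Z <= 2 * D ->
  det2 P P' ^+ 2 * `|al * be| <= 128 * (m * E) ^+ 2.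
Proof.
move=> D0 m0 E0 f f' h h'.
have [big|/ltW s] := lerP (`|be| * P.2%:Z ^+ 2) (2 * `|al| * P.1%:Z ^+ 2).
  exact: (det2_bound_large D0).
have [big|/ltW s'] := lerP (`|be| * P'.2%:Z ^+ 2) (2 * `|al| * P'.1%:Z ^+ 2).
  rewrite -sqrrN -det2C; exact: (det2_bound_large D0).
exact: (det2_bound_small D0).
Qed.

Definition admissible (al be : int) (m T E D : nat) (P : nat * nat) : Prop :=
  [/\ coprime P.1 P.2, (D <= P.2 < 2 * D)%N, (gcdn P.1 m %| T)%N,
      (gcdn P.2 m %| T)%N &
      (m%:Z %| form2 al be P)%Z /\ `|form2 al be P| <= m%:Z * E%:Z].

(** Equal determinants make [P - P'] a multiple of the primitive vector [P0]. The second coordinates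
    differ by less than [D <= P0.2], so the multiple is zero. *)
Lemma det2_inj (D : nat) (P0 P P' : nat * nat) : coprime P0.1 P0.2 ->
  (D <= P0.2 < 2 * D)%N -> (D <= P.2 < 2 * D)%N -> (D <= P'.2 < 2 * D)%N ->
  det2 P0 P = det2 P0 P' -> P = P'.
Proof.
case: P0 P P' => [a b] [c d] [c' d'] /=; rewrite /det2 /= => cop h0 h h' e.
have e1 : a%:Z * (d%:Z - d'%:Z) = b%:Z * (c%:Z - c'%:Z) by move: e; lia.
have : (b%:Z %| a%:Z * (d%:Z - d'%:Z))%Z by rewrite e1 dvdz_mulr.
rewrite Gauss_dvdzr; last by rewrite coprimezE /= coprime_sym.
move=> /dvdzP[q qE].
have q0 : q = 0 by nia.
have dd : d = d' by move: qE; rewrite q0; lia.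
move: e1; rewrite dd subrr mulr0 => /esym/eqP; rewrite mulf_eq0 => /orP[/eqP|/eqP].
  by move: h0 => /andP[] *; exfalso; lia.
by move=> ce; congr pair; lia.
Qed.

(** A point is coded by its class [d = gcd(m, det2 P0 P)] and by [r], where [r * m] is [2 * T ^ 4]
    times its determinant with a reference point of the class. The bound on [r] comes from
    [det2_bound], with [512 = 2 ^ 2 * 128], and [det2_inj] recovers the point. *)
Lemma admissible_embedding (al be : int) (m T E D : nat) :
  (0 < m)%N -> (0 < T)%N -> (0 < D)%N -> (gcdz al m %| T%:Z)%Z ->
  exists phi : nat * nat -> nat * int,
    (forall P, admissible al be m T E D P ->
       ((phi P).1 %| m)%N /\
       (phi P).2 ^+ 2 * `|al * be| <= 512 * T%:Z ^+ 8 * E%:Z ^+ 2) /\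
    (forall P P', admissible al be m T E D P -> admissible al be m T E D P' ->
       phi P = phi P' -> P = P').
Proof.
move=> m0 T0 D0 gal; set adm := admissible al be m T E D.
have [[P0 aP0]|nP] := pselect (exists P0, adm P0); last first.
  exists (fun _ => (0%N, 0)); split => [P aP|P P' aP]; by case: nP; exists P.
pose cls P := gcdn m `|det2 P0 P|%N.
(* The reference point of a class is chosen once, so it depends on the class only; empty classes
   receive the default [P0]. *)
have [ref refP] : exists ref : nat -> nat * nat,
    forall P, adm P -> adm (ref (cls P)) /\ cls (ref (cls P)) = cls P.
  have /choice[ref H] : forall d, exists Q, forall P, adm P -> cls P = d ->
      adm Q /\ cls Q = d.
    move=> d; have [[Q [aQ Qd]]|nQ] := pselect (exists Q, adm Q /\ cls Q = d).
      by exists Q.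
    by exists P0 => P aP Pd; case: nQ; exists P.
  exists ref => P aP; exact: (H _ P aP erefl).
have mz0 : m%:Z != 0 by rewrite eqz_nat -lt0n.
have dv P : adm P -> (m%:Z %| 2 * T%:Z ^+ 4 * det2 (ref (cls P)) P)%Z.
  move=> aP; have [aQ Qd] := refP _ aP.
  case: aP0 => cop _ g1 _ [d0 _]; case: aP => _ _ _ _ [d1 _].
  case: aQ => _ _ _ g2 [d2 _].
  apply: (@dvdz_det2_class al be _ _ P0) => //.
  by rewrite /gcdz; congr Posz; exact: Qd.
pose r P := ((2 * T%:Z ^+ 4 * det2 (ref (cls P)) P) %/ m%:Z)%Z.
have rE P : adm P -> r P * m%:Z = 2 * T%:Z ^+ 4 * det2 (ref (cls P)) P.
  by move=> aP; rewrite /r divzK // dv.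
exists (fun P => (cls P, r P)); split => [P aP /=|P P' aP aP' [ec er]].
  split; first exact: dvdn_gcdl.
  have [aQ Qd] := refP _ aP.
  have bd : det2 (ref (cls P)) P ^+ 2 * `|al * be| <= 128 * (m%:Z * E%:Z) ^+ 2.
    case: (aQ) => _ h _ _ [_ f]; case: (aP) => _ h' _ _ [_ f'].
    apply: (@det2_bound _ _ _ _ D%:Z) => //; lia.
  have M2 : 0 < m%:Z ^+ 2 by rewrite exprn_gt0.
  rewrite -(ler_pM2r M2).
  have -> : r P ^+ 2 * `|al * be| * m%:Z ^+ 2 = (r P * m%:Z) ^+ 2 * `|al * be| by ring.
  rewrite rE //.
  have -> : (2 * T%:Z ^+ 4 * det2 (ref (cls P)) P) ^+ 2 * `|al * be| =
     (4 * T%:Z ^+ 8) * (det2 (ref (cls P)) P ^+ 2 * `|al * be|) by ring.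
  have -> : 512 * T%:Z ^+ 8 * E%:Z ^+ 2 * m%:Z ^+ 2 =
     (4 * T%:Z ^+ 8) * (128 * (m%:Z * E%:Z) ^+ 2) by ring.
  by rewrite ler_wpM2l // mulr_ge0 // exprn_ge0.
have [aQ Qd] := refP _ aP.
case: (aQ) => copQ hQ _ _ _; case: (aP) => _ h _ _ _; case: (aP') => _ h' _ _ _.
apply: (det2_inj copQ hQ h h').
have T4 : 2 * T%:Z ^+ 4 != 0 :> int by rewrite mulf_neq0 // expf_neq0 // eqz_nat -lt0n.
apply: (mulfI T4); rewrite -rE // er rE //.
by rewrite ec.
Qed.

(** * Representations by binary quadratic forms *)

Lemma count_le_absz_leq K : count_le (fun r : int => `|r| <= K)%N (K.+1 * 2).
Proof.
apply: (count_le_absz (P := fun k => (k <= K)%N)).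
rewrite -(size_iota 0 K.+1); apply: count_le_seq => k kK.
by rewrite mem_iota add0n ltnS.
Qed.

Lemma trunc_log2_bounds n : (0 < n)%N ->
  (2 ^ trunc_log 2 n <= n < 2 * 2 ^ trunc_log 2 n)%N.
Proof. by move=> n0; rewrite trunc_logP // -expnS trunc_log_ltn. Qed.

Lemma coprime_divn_gcd (a b : nat) : (0 < gcdn a b)%N ->
  coprime (a %/ gcdn a b) (b %/ gcdn a b).
Proof.
move=> g0; rewrite /coprime -(eqn_pmul2r g0) mul1n muln_gcdl.
by rewrite !divnK ?dvdn_gcdl ?dvdn_gcdr.
Qed.

Lemma PoszX (a k : nat) : (a ^ k)%N%:Z = a%:Z ^+ k.
Proof. by rewrite -!natz natrX. Qed.

(** Dividing by the gcd [G] of the coordinates leaves primitive points on which the form equals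
    [m = |n| / G ^ 2] up to sign. They are admissible for the modulus [m] itself, with [E = 1] and
    [T = |D|]. The three factors [tau M] count [G], the dyadic range and the class modulo [m]. *)
Lemma count_norm_eq_nat (D : int) : D != 0 -> exists c : nat,
  forall (n : int) (M : nat), n != 0 -> (`|n| <= M)%N ->
  count_le (fun w : nat * nat => form2 1 (- D) w = n /\ (0 < w.2 <= M)%N)
    (c * tau M ^ 3).
Proof.
move=> D0; pose K := (512 * `|D| ^ 8)%N.
exists (K.+1 * 2)%N => n M n0 nM.
have -> : ((K.+1 * 2) * tau M ^ 3 = tau M * tau M * (tau M * (K.+1 * 2)))%N.
  by rewrite !expnS expn0; ring.
have an0 : (0 < `|n|)%N by rewrite absz_gt0.
pose key (w : nat * nat) := (gcdn w.1 w.2, trunc_log 2 (w.2 %/ gcdn w.1 w.2)).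
apply: (count_le_fiber (f := key)
    (Q := fun y => (y.1 %| `|n|)%N /\ (2 ^ y.2 <= M)%N)).
- move=> [U V] /= [e /andP[V0 VM]].
  have g0 : (0 < gcdn U V)%N by rewrite gcdn_gt0 V0 orbT.
  split.
    have : ((gcdn U V)%:Z %| n)%Z.
      rewrite -e /form2 /= rpredD // dvdz_mull // expr2 dvdz_mull //.
        by rewrite dvdzE /= dvdn_gcdl.
      by rewrite dvdzE /= dvdn_gcdr.
    by rewrite dvdzE.
  apply: leq_trans VM; apply: leq_trans (leq_div V (gcdn U V)).
  by rewrite trunc_logP // divn_gt0 // dvdn_leq // dvdn_gcdr.
- apply: (count_le_prod (P := fun d => (d %| `|n|)%N) (Q := fun l => (2 ^ l <= M)%N));
    last exact: count_le_log.
  apply: count_le_weaken (count_le_divisors an0) _.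
  exact: size_divisors_tau.
move=> [G j].
have [[w0 [[e0 /andP[w00 _]] k0]]|nw] := pselect (exists w : nat * nat,
  (form2 1 (- D) w = n /\ (0 < w.2 <= M)%N) /\ key w = (G, j)); last first.
  apply: (@count_le_weaken _ _ 0%N) => // -[|w s] // _ sP.
  by case: nw; exists w; apply: sP; rewrite mem_head.
have G0 : (0 < G)%N.
  by move: k0 => [<- _]; rewrite gcdn_gt0 w00 orbT.
have Gn : (G ^ 2 %| `|n|)%N.
  have : (G%:Z ^+ 2 %| n)%Z.
    move: k0 => [<- _]; rewrite -e0 /form2 rpredD // dvdz_mull //.
      by rewrite dvdz_exp2r // dvdzE /= dvdn_gcdl.
    by rewrite dvdz_exp2r // dvdzE /= dvdn_gcdr.
  by rewrite dvdzE abszX.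
pose m := (`|n| %/ G ^ 2)%N.
have mE : (m * G ^ 2 = `|n|)%N by rewrite divnK.
have m0 : (0 < m)%N by move: an0; rewrite -mE muln_gt0 => /andP[].
have D0' : (0 < `|D|)%N by rewrite absz_gt0.
have j0 : (0 < 2 ^ j)%N by rewrite expn_gt0.
have gal : (gcdz 1 m %| `|D|%:Z)%Z by rewrite gcd1z dvd1z.
have [phi [phiP phiI]] := @admissible_embedding 1 (- D) m `|D|%N 1 (2 ^ j) m0 D0' j0 gal.
pose red (w : nat * nat) := (w.1 %/ G, w.2 %/ G)%N.
have redP w : form2 1 (- D) w = n -> (0 < w.2 <= M)%N -> key w = (G, j) ->
    [/\ w.1 = ((red w).1 * G)%N, w.2 = ((red w).2 * G)%N &
    admissible 1 (- D) m `|D|%N 1 (2 ^ j) (red w)].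
  case: w => [U V] /= e /andP[V0 VM] [Ge je].
  have g0 : (0 < gcdn U V)%N by rewrite gcdn_gt0 V0 orbT.
  have GU : (G %| U)%N by rewrite -Ge dvdn_gcdl.
  have GV : (G %| V)%N by rewrite -Ge dvdn_gcdr.
  rewrite !divnK //; split => //.
  have cop : coprime (U %/ G) (V %/ G) by rewrite -Ge coprime_divn_gcd.
  have fE : `|form2 1 (- D) (U %/ G, V %/ G)%N| = m%:Z.
    have G2 : G%:Z ^+ 2 != 0 by rewrite expf_neq0 // eqz_nat -lt0n.
    have e2 : form2 1 (- D) (U %/ G, V %/ G)%N * G%:Z ^+ 2 = n.
      rewrite -e /form2 /= -{2}(divnK GU) -{2}(divnK GV) !PoszM; ring.
    apply: (mulIf G2); have := congr1 Num.norm e2.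
    rewrite normrM [`|G%:Z ^+ 2|]ger0_norm ?sqr_ge0 // => ->.
    by rewrite -abszE -mE PoszM expnS expn1 expr2 PoszM.
  have mf : (m%:Z %| form2 1 (- D) (U %/ G, V %/ G)%N)%Z.
    have [fE'] : `|form2 1 (- D) (U %/ G, V %/ G)%N|%N%:Z = m%:Z by rewrite abszE.
    by rewrite dvdzE fE'.
  split => //=.
  - rewrite -je Ge; apply: trunc_log2_bounds.
    by rewrite divn_gt0 // dvdn_leq.
  - set c := (U %/ G)%N; set d := (V %/ G)%N.
    (* A common divisor of [c] and [m] divides [D * d ^ 2], hence [D] because [c] and [d] are
       coprime. In the next case the same reasoning gives gcd 1. *)
    have : ((gcdn c m)%:Z %| D * d%:Z ^+ 2)%Z.
      have -> : D * d%:Z ^+ 2 = c%:Z ^+ 2 - form2 1 (- D) (c, d).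
        by rewrite /form2 /=; ring.
      rewrite rpredB //.
        by rewrite expr2 dvdz_mull // dvdzE /= dvdn_gcdl.
      by apply: dvdz_trans mf; rewrite dvdzE /= dvdn_gcdr.
    rewrite Gauss_dvdzl ?dvdzE //.
    rewrite coprimezE abszX coprimeXr //=.
    by apply: coprime_dvdl cop; rewrite dvdn_gcdl.
  - set c := (U %/ G)%N; set d := (V %/ G)%N.
    have : ((gcdn d m)%:Z %| 1 * c%:Z ^+ 2)%Z.
      have -> : 1 * c%:Z ^+ 2 = D * d%:Z ^+ 2 + form2 1 (- D) (c, d).
        by rewrite /form2 /=; ring.
      rewrite rpredD //.
        by rewrite expr2 mulrA dvdz_mull // dvdzE /= dvdn_gcdl.
      by apply: dvdz_trans mf; rewrite dvdzE /= dvdn_gcdr.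
    rewrite Gauss_dvdzl ?dvdzE //.
      by rewrite dvdn1 /= => /eqP ->; rewrite dvd1n.
    rewrite coprimezE abszX coprimeXr //=.
    by apply: coprime_dvdl (_ : coprime d c); rewrite ?dvdn_gcdl // coprime_sym.
  - split=> //; rewrite fE; lia.
apply: (count_le_inj (f := fun w => phi (red w))
   (Q := fun z => (z.1 %| m)%N /\ (`|z.2| <= K)%N)).
- move=> w [[e wM] kw]; have [_ _ aw] := redP _ e wM kw.
  have [h1 h2] := phiP _ aw; split=> //.
  have {}h2 : (`|(phi (red w)).2| ^ 2 * `|D| <= 512 * `|D| ^ 8)%N.
    rewrite mul1r normrN expr1n mulr1 in h2.
    by rewrite -lez_nat -abszX PoszM [`|_ ^+ 2|%N%:Z]abszE [`|_ ^+ 2|]ger0_norm ?sqr_ge0 //.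
  apply: leq_trans h2; rewrite expnS expn1.
  by case: (`|(phi (red w)).2|)%N => // k; rewrite -mulnA leq_pmulr // muln_gt0 D0'.
- move=> w w' [[e wM] kw] [[e' wM'] kw'].
  have [h1 h2 aw] := redP _ e wM kw; have [h1' h2' aw'] := redP _ e' wM' kw'.
  move=> /(phiI _ _ aw aw') er.
  by rewrite [w]surjective_pairing [w']surjective_pairing h1 h2 h1' h2' er.
apply: (count_le_prod (P := fun d => (d %| m)%N) (Q := fun r : int => (`|r| <= K)%N));
  last exact: count_le_absz_leq.
apply: count_le_weaken (count_le_divisors m0) _.
by apply: size_divisors_tau; apply: leq_trans nM; rewrite -mE leq_pmulr // expn_gt0 G0.
Qed.

(** Signs cost a factor 4. Solutions with second coordinate zero lie outside the previous count and
    are allotted the extra 4. *)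
Lemma count_norm_eq (D : int) : D != 0 -> exists c : nat,
  forall (n : int) (M : nat), n != 0 -> (`|n| <= M)%N ->
  count_le (fun w : int * int => w.1 ^+ 2 - D * w.2 ^+ 2 = n /\ (`|w.2| <= M)%N)
    (c * tau M ^ 3).
Proof.
move=> D0; have [c cP] := count_norm_eq_nat D0.
exists (c * 4 + 4)%N => n M n0 nM.
have M0 : (0 < M)%N by apply: leq_trans nM; rewrite absz_gt0.
have t0 : (0 < tau M ^ 3)%N by rewrite expn_gt0 tau_gt0.
have formE (w : int * int) : form2 1 (- D) (`|w.1|%N, `|w.2|%N) = w.1 ^+ 2 - D * w.2 ^+ 2.
  by rewrite /form2 /= !abszE !real_normK ?num_real // mul1r mulNr.
have sgn2 (a b : nat) : count_le (fun w : int * int => `|w.1|%N = a /\ `|w.2|%N = b) 4.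
  have one (k : nat) : count_le (fun z : int => `|z|%N = k) (1 * 2).
    apply: (count_le_absz (P := fun x => x = k)).
    by apply: (@count_le_seq _ _ [:: k]) => x ->; rewrite mem_head.
  exact: (count_le_prod (one a) (one b)).
apply: (@count_le_weaken _ _ (c * tau M ^ 3 * 4 + 4)); last first.
  by move: t0; set t := (tau M ^ 3)%N; nia.
apply: (count_le_sub (Q := fun w : int * int =>
  (w.1 ^+ 2 - D * w.2 ^+ 2 = n /\ (0 < `|w.2| <= M)%N) \/
  (w.1 ^+ 2 = n /\ w.2 = 0))).
  move=> [U V] /= [e VM]; have [V0|V0] := eqVneq V 0.
    by right; split => //; rewrite -e V0 expr0n /= mulr0 subr0.
  by left; rewrite absz_gt0 V0.
apply: count_le_or.
  apply: (count_le_fiber (f := fun w : int * int => (`|w.1|%N, `|w.2|%N)) _ (cP n M n0 nM)).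
    by move=> w [e wM]; rewrite formE.
  move=> [a b]; apply: count_le_sub (sgn2 a b) => w [_ [-> ->]] //.
have [[U0 e0]|nU] := pselect (exists U : int, U ^+ 2 = n).
  apply: count_le_sub (sgn2 `|U0|%N 0%N) => -[U V] /= [e ->]; split => //.
  have /eqP : U ^+ 2 = U0 ^+ 2 by rewrite e.
  by rewrite eqf_sqr => /orP[/eqP->|/eqP->] //; rewrite abszN.
apply: (@count_le_weaken _ _ 0%N) => // -[|w s] // _ sP.
by case: nU; exists w.1; have [] := sP w (mem_head _ _).
Qed.

Definition bq (a b c u v : int) : int := a * u ^+ 2 + b * (u * v) + c * v ^+ 2.

(** An injective substitution [(U, V)] turns [mu] times the form into a norm form. The substitution
    is left abstract so that all shapes of the form share the argument. *)
Lemma count_bq_diag (a b c D mu : int) (s : nat) (U V : int -> int -> int) :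
  D != 0 -> mu != 0 -> (`|mu| <= 4 * s)%N -> (0 < s)%N ->
  (forall u v, U u v ^+ 2 - D * V u v ^+ 2 = mu * bq a b c u v) ->
  (forall u v B, (`|u| <= B -> `|v| <= B -> `|bq a b c u v| <= s * B ^ 2)%N) ->
  (forall u v B, (`|u| <= B -> `|v| <= B -> `|V u v| <= 2 * s * B)%N) ->
  (forall u v u' v', U u v = U u' v' -> V u v = V u' v' -> u = u' /\ v = v') ->
  exists c0 : nat, forall (q : int) (B : nat), (0 < B)%N -> q != 0 ->
  count_le (fun w : int * int => bq a b c w.1 w.2 = q /\ (`|w.1| <= B)%N /\ (`|w.2| <= B)%N)
    (c0 * tau (4 * s ^ 2 * B ^ 2) ^ 3).
Proof.
move=> D0 mu0 mus s0 UV bQ bV UVI; have [c0 cP] := count_norm_eq D0.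
exists c0 => q B B0 q0.
(* A single solution in the box already bounds [q] by [s * B ^ 2], which brings [mu * q] within the
   range of [tau]. *)
have [[[u1 v1] /= [e1 [hu hv]]]|nw] := pselect (exists w : int * int,
  bq a b c w.1 w.2 = q /\ (`|w.1| <= B)%N /\ (`|w.2| <= B)%N); last first.
  by move=> [|w l] // _ sP; case: nw; exists w; apply: sP; rewrite mem_head.
have qB : (`|q| <= s * B ^ 2)%N by rewrite -e1; apply: bQ.
have n0 : mu * q != 0 by rewrite mulf_neq0.
have nM : (`|(mu * q)%R| <= 4 * s ^ 2 * B ^ 2)%N.
  rewrite abszM; apply: leq_trans (leq_mul mus qB) _.
  by rewrite [(s ^ 2)%N]expnS expn1; nia.
apply: (count_le_inj (f := fun w => (U w.1 w.2, V w.1 w.2)) _ _ (cP _ _ n0 nM)).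
  move=> [u v] /= [e [uB vB]]; rewrite UV e; split => //.
  apply: leq_trans (bV _ _ _ uB vB) _.
  have sB : (0 < s * B)%N by rewrite muln_gt0 s0.
  have -> : (4 * s ^ 2 * B ^ 2 = 4 * ((s * B) * (s * B)))%N by ring.
  by rewrite -mulnA leq_mul // leq_pmulr.
move=> [u v] [u' v'] /= _ _ [eU eV].
by have [-> ->] := UVI _ _ _ _ eU eV.
Qed.

Lemma leq_bq (a b c u v : int) (B : nat) : (`|u| <= B -> `|v| <= B ->
  `|bq a b c u v| <= (`|a| + `|b| + `|c|) * B ^ 2)%N.
Proof.
move=> uB vB; rewrite /bq expnS expn1 [u ^+ 2]expr2 [v ^+ 2]expr2.
have h (d x y : int) : (`|x| <= B -> `|y| <= B -> `|(d * (x * y))%R| <= `|d| * (B * B))%N.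
  by move=> xB yB; rewrite !abszM leq_mul // leq_mul.
have := h a u u uB uB; have := h b u v uB vB; have := h c v v vB vB.
rewrite !mulnDl; lia.
Qed.

(** Complete the square in [u] if [a] is nonzero, in [v] if [c] is nonzero; otherwise the form is
    [b * u * v], and [(u + v) ^ 2 - (u - v) ^ 2 = 4 * u * v]. *)
Lemma count_bq (a b c : int) : b ^+ 2 - 4 * a * c != 0 ->
  exists c0 k : nat, (0 < k)%N /\ forall (q : int) (B : nat), (0 < B)%N -> q != 0 ->
  count_le (fun w : int * int => bq a b c w.1 w.2 = q /\ (`|w.1| <= B)%N /\ (`|w.2| <= B)%N)
    (c0 * tau (k * B ^ 2) ^ 3).
Proof.
move=> D0; pose s := (`|a| + `|b| + `|c|)%N.
have s0 : (0 < s)%N.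
  rewrite lt0n; apply: contraNneq D0 => s0; rewrite /s in s0.
  have [-> [-> ->]] : a = 0 /\ b = 0 /\ c = 0 by lia.
  by [].
have bQ u v B := @leq_bq a b c u v B.
suff [c0 H] : exists c0 : nat, forall (q : int) (B : nat), (0 < B)%N -> q != 0 ->
  count_le (fun w : int * int => bq a b c w.1 w.2 = q /\ (`|w.1| <= B)%N /\ (`|w.2| <= B)%N)
    (c0 * tau (4 * s ^ 2 * B ^ 2) ^ 3).
  by exists c0, (4 * s ^ 2)%N; split=> //; rewrite muln_gt0 expn_gt0 s0.
have [a0|a0] := eqVneq a 0; last first.
  apply: (@count_bq_diag a b c _ (4 * a) s (fun u v => 2 * a * u + b * v) (fun _ v => v) D0) => //.
  - by rewrite mulf_neq0.
  - by rewrite /s; lia.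
  - by move=> u v; rewrite /bq; ring.
  - by move=> u v B _ vB; nia.
  - move=> u v u' v' + e; rewrite e => /addIr /mulfI -> //.
    by rewrite mulf_neq0.
have [c0|c0] := eqVneq c 0; last first.
  apply: (@count_bq_diag a b c _ (4 * c) s (fun u v => 2 * c * v + b * u) (fun u _ => u) D0) => //.
  - by rewrite mulf_neq0.
  - by rewrite /s; lia.
  - by move=> u v; rewrite /bq; ring.
  - by move=> u v B vB _; nia.
  - move=> u v u' v' + e; rewrite e => /addIr /mulfI -> //.
    by rewrite mulf_neq0.
have b0 : b != 0 by apply: contraNneq D0 => ->; rewrite a0 c0.
apply: (@count_bq_diag a b c 1 (4 * b) s (fun u v => b * (u + v)) (fun u v => b * (u - v))) => //.
- by rewrite mulf_neq0.
- by rewrite /s; lia.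
- by move=> u v; rewrite /bq a0 c0; ring.
- move=> u v B uB vB; rewrite abszM.
  have : (`|(u - v)%R| <= 2 * B)%N by lia.
  have : (`|b| <= s)%N by rewrite /s; lia.
  move=> h1 h2; apply: leq_trans (leq_mul h1 h2) _; lia.
- move=> u v u' v' /(mulfI b0) e1 /(mulfI b0) e2; lia.
Qed.

(** * The descent equation *)

Lemma dvdn_gcd_mull (a b m : nat) : (gcdn (a * b) m %| a * gcdn b m)%N.
Proof. by rewrite muln_gcdr dvdn_gcd dvdn_gcdl dvdn_mull // dvdn_gcdr. Qed.

(* [(h1, h2, h3, (b1, b2, b3), k)] in the notation above. *)
Definition descent_datum : eqType := (int * int * int * (nat * nat * nat) * nat)%type.

(** The common factor [|h1 * h2 * h3| * k ^ 2] in the size conditions stands for [T ^ 2 * g], so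
    these conditions bound [T ^ 2 * |x - e_i q|]. *)
Definition descent_eq (l1 l2 l3 : int) (T C B : nat) (t : descent_datum) : Prop :=
  let: (h1, h2, h3, (b1, b2, b3), k) := t in
  [/\ [/\ h1 != 0, h2 != 0 & h3 != 0],
      [/\ 0 < b1, 0 < b2, 0 < b3 & 0 < k]%N,
      l1 * h1 * b1%:Z ^+ 2 + l2 * h2 * b2%:Z ^+ 2 + l3 * h3 * b3%:Z ^+ 2 = 0,
      [/\ gcdn (`|h1| * b1 ^ 2) (`|h2| * b2 ^ 2) %| T,
          gcdn (`|h1| * b1 ^ 2) (`|h3| * b3 ^ 2) %| T &
          gcdn (`|h2| * b2 ^ 2) (`|h3| * b3 ^ 2) %| T]%N &
      [/\ `|h1| * `|h2| * `|h3| * k ^ 2 * (`|h1| * b1 ^ 2) <= C * B ^ 2,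
          `|h1| * `|h2| * `|h3| * k ^ 2 * (`|h2| * b2 ^ 2) <= C * B ^ 2 &
          `|h1| * `|h2| * `|h3| * k ^ 2 * (`|h3| * b3 ^ 2) <= C * B ^ 2]%N].

(** What is fixed before the lattice argument: of [h3] and of the reduced [b2] only the dyadic
    ranges are kept, and of [b1] only its gcd with [b2]. *)
Definition descent_key (t : descent_datum) : int * int * nat * nat * nat * nat * nat :=
  let: (h1, h2, h3, (b1, b2, b3), k) := t in
  (h1, h2, b3, k, gcdn b1 b2, trunc_log 2 `|h3|, trunc_log 2 (b2 %/ gcdn b1 b2)).

Definition descent_target (T K M B : nat)
    (z : int * int * nat * nat * nat * nat * nat * (nat * int)) : Prop :=
  let: (h1, h2, b3, k, G, L, j, (d, r)) := z in
  [/\ h1 != 0, h2 != 0, (0 < b3)%N, (0 < k)%N & [/\ (G %| T)%N,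
      (2 ^ L <= M)%N, (2 ^ j <= M)%N, (d %| b3 ^ 2)%N /\ (b3 ^ 2 <= M)%N &
      (`|h1| * `|h2| * b3 * k * maxn `|r| 1 <= K * B)%N]].

(** Once the product [n = |h1| * |h2| * b3 * k * max(|r|, 1)], at most [K * B], is fixed, all its
    factors are divisors of [n]. This keeps the count linear in [B] up to powers of [tau M]. *)
Lemma count_descent_target (T K M B : nat) : (0 < T)%N -> (0 < M)%N -> (K * B <= M)%N ->
  count_le (descent_target T K M B) (K * B * (16 * size (divisors T) * tau M ^ 8)).
Proof.
move=> T0 M0 KM.
pose prd (z : int * int * nat * nat * nat * nat * nat * (nat * int)) : nat :=
  let: (h1, h2, b3, k, G, L, j, (d, r)) := z in (`|h1| * `|h2| * b3 * k * maxn `|r| 1)%N.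
apply: (count_le_fiber (f := prd) (Q := fun n => (0 < n <= K * B)%N)).
- move=> [[[[[[[h1 h2] b3] k] G] L] j] [d r]] /= [h10 h20 b30 k0 [_ _ _ _ ->]].
  by rewrite andbT !muln_gt0 !absz_gt0 h10 h20 b30 k0 leq_max orbT.
- exact: count_le_leq.
move=> n; have [n0|n0] := posnP n.
  move=> [|z s] // _ sP; have [] := sP z (mem_head _ _).
  case: z {sP} => [[[[[[[h1 h2] b3] k] G] L] j] [d r]] /= [h10 h20 b30 k0 _] /eqP.
  by rewrite n0 !muln_eq0 !absz_eq0 (negPf h10) (negPf h20) !eqn0Ngt b30 k0 leq_max orbT.
have [nM|nM] := leqP n M; last first.
  move=> [|z s] // _ sP; have [] := sP z (mem_head _ _).
  case: z {sP} => [[[[[[[h1 h2] b3] k] G] L] j] [d r]] /= [_ _ _ _ [_ _ _ _ h]] e.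
  by move: nM; rewrite ltnNge -e (leq_trans h).
have divc : count_le (fun d => (d %| n)%N) (tau M).
  apply: count_le_weaken (count_le_divisors n0) _; exact: size_divisors_tau.
have divz := count_le_absz divc.
have divT := count_le_divisors T0.
have maxc : count_le (fun d => (maxn d 1 %| n)%N) (2 * tau M).
  apply: (@count_le_weaken _ _ (1 + tau M)); last first.
    by rewrite mul2n -addnn leq_add2r tau_gt0.
  apply: (count_le_sub (Q := fun d => d = 0%N \/ (d %| n)%N)).
    by case=> [|d]; [left | right].
  apply: count_le_or divc.
  by apply: (@count_le_seq _ _ [:: 0%N]) => x ->; rewrite mem_head.
have maxz := count_le_absz maxc.
have logc := @count_le_log M.
have H := count_le_prod (count_le_prod (count_le_prod (count_le_prod (count_le_prod
  (count_le_prod (count_le_prod divz divz) divc) divc) divT) logc) logc) maxz.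
pose proj (z : int * int * nat * nat * nat * nat * nat * (nat * int)) :=
  (z.1, z.2.2).
(* The eight factors [tau M] are for [h1], [h2], [b3], [k], [L], [j], [r] and [d]. The 16 covers the
   signs of [h1], [h2] and [r] and the doubling that admits [r = 0]. *)
have -> : (16 * size (divisors T) * tau M ^ 8 =
  tau M * 2 * (tau M * 2) * tau M * tau M * size (divisors T) * tau M * tau M *
  (2 * tau M * 2) * tau M)%N by ring.
apply: (count_le_fiber (f := proj) _ H).
- move=> [[[[[[[h1 h2] b3] k] G] L] j] [d r]] /= [[_ _ _ _ [GT LM jM _ _]] e].
  rewrite -e /=; set x := `|h1|%N; set y := `|h2|%N; set w := maxn _ _.
  split; last by rewrite dvdn_mull.
  do ![split => //].
  + by do 4 apply: dvdn_mulr.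
  + by do 3 apply: dvdn_mulr; exact: dvdn_mull.
  + by do 2 apply: dvdn_mulr; exact: dvdn_mull.
  + by apply: dvdn_mulr; exact: dvdn_mull.
(* The divisor [d] of [b3 ^ 2] is counted last, since its range depends on [b3]. *)
- move=> [[[[[[[h1 h2] b3] k] G] L] j] r0].
  have [b3M|b3M] := boolP ((0 < b3) && (b3 ^ 2 <= M))%N; last first.
    move=> [|z s] // _ sP; have [] := sP z (mem_head _ _).
    case: z {sP} => [[[[[[[h1' h2'] b3'] k'] G'] L'] j'] [d r]] /=.
    move=> [[_ _ b30 _ [_ _ _ [_ b3'M] _]] _] [_ _ e _ _ _ _ _].
    by move: b3M; rewrite -e b30 b3'M.
  move: b3M => /andP[b30 b3M].
  have b320 : (0 < b3 ^ 2)%N by rewrite expn_gt0 b30.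
  apply: (@count_le_weaken _ _ (size (divisors (b3 ^ 2)))); last exact: size_divisors_tau.
  apply: (count_le_inj (f := fun z => z.2.1) _ _ (count_le_divisors b320)).
    move=> [[[[[[[h1' h2'] b3'] k'] G'] L'] j'] [d r]] /=.
    by move=> [[[_ _ _ _ [_ _ _ [dd _] _]] _] [_ _ <- _ _ _ _ _]].
  move=> [y [d r]] [y' [d' r']] /= [_ [-> ->]] [_ [-> ->]] -> //.
Qed.

Lemma leq_mul_gt0r (a b n : nat) : (0 < b)%N -> (a * b <= n)%N -> (a <= n)%N.
Proof. by move=> b0; apply: leq_trans; rewrite leq_pmulr. Qed.

Lemma leq_mul_gt0l (a b n : nat) : (0 < a)%N -> (a * b <= n)%N -> (b <= n)%N.
Proof. by move=> a0; apply: leq_trans; rewrite leq_pmull. Qed.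

(** For [s = 1] and for [s = r] one has [s ^ 2 * a * b <= t * h ^ 2]. Multiplying by
    [a * b * k ^ 2 * b3 ^ 2] bounds the square of the product by [t * C * B ^ 2]. *)
Lemma descent_size (a b h b3 k L r C K B t : nat) :
  (0 < t)%N -> (t * C <= K)%N -> (0 < K)%N ->
  (a <= h -> b <= h -> 2 ^ L <= h ->
  r ^ 2 * (a * b) <= t * (2 ^ L) ^ 2 ->
  a * b * h * k ^ 2 * (h * b3 ^ 2) <= C * B ^ 2 ->
  a * b * b3 * k * maxn r 1 <= K * B)%N.
Proof.
move=> t0 tK K0 ah bh Lh hr hC.
have step (s : nat) : (s ^ 2 * (a * b) <= t * h ^ 2)%N ->
    (a * b * b3 * k * s <= K * B)%N.
  move=> hs; rewrite -leq_sqr.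
  apply: (@leq_trans (t * (C * B ^ 2))); last first.
    rewrite mulnA expnMn leq_mul2r; apply/orP; right.
    by apply: leq_trans tK _; rewrite expnS expn1 leq_pmulr.
  apply: (@leq_trans (t * (a * b * h * k ^ 2 * (h * b3 ^ 2)))); last by rewrite leq_mul2l hC orbT.
  have -> : ((a * b * b3 * k * s) ^ 2 = (s ^ 2 * (a * b)) * (a * b * (k ^ 2 * b3 ^ 2)))%N by ring.
  have -> : (t * (a * b * h * k ^ 2 * (h * b3 ^ 2)) =
     (t * h ^ 2) * (a * b * (k ^ 2 * b3 ^ 2)))%N by ring.
  by rewrite leq_mul2r hs orbT.
rewrite /maxn; case: ifP => _; apply: step.
  rewrite exp1n mul1n expnS expn1; apply: leq_trans (leq_mul ah bh) _.
  by rewrite leq_pmull.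
by apply: leq_trans hr _; rewrite leq_mul2l leq_sqr Lh orbT.
Qed.

(** For a fixed key the reduced pair [(b1 / G, b2 / G)] is admissible modulo [b3 ^ 2], and its class
    and multiplier [r] complete the key to a point of [descent_target]. *)
Lemma count_descent_max3 (l1 l2 l3 : int) (T C : nat) :
  l1 != 0 -> l2 != 0 -> l3 != 0 -> (0 < T)%N ->
  exists c K : nat, (0 < K)%N /\ forall B : nat, (0 < B)%N ->
  count_le (fun t => descent_eq l1 l2 l3 T C B t /\
      let: (h1, h2, h3, (b1, b2, b3), k) := t in (`|h1| <= `|h3|)%N /\ (`|h2| <= `|h3|)%N)
    (c * B * tau (K * B ^ 2) ^ 8).
Proof.
move=> l10 l20 l30 T0.
(* The coefficient [al] below contains [l1], which can enlarge its gcd with [b3 ^ 2] by a factor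
   dividing [l1]. *)
pose T' := (`|l1| * T)%N.
have T'0 : (0 < T')%N by rewrite muln_gt0 absz_gt0 l10.
(* The bound of [admissible_embedding] for [E = 2 * |l3| * 2 ^ L], with [(2 ^ L) ^ 2] taken out. *)
pose w := (512 * T' ^ 8 * (2 * `|l3|) ^ 2)%N.
have w0 : (0 < w)%N.
  by rewrite muln_gt0 [(0 < 512 * _)%N]muln_gt0 !expn_gt0 T'0 muln_gt0 absz_gt0 l30.
pose K := (w * C + C + 1)%N.
exists (K * (16 * size (divisors T)))%N, K; split; first by rewrite /K addn1.
move=> B B0; pose M := (K * B ^ 2)%N.
have KM : (K * B <= M)%N by rewrite /M expnS expn1 leq_mul2l leq_pmulr // orbT.
have M0 : (0 < M)%N by rewrite muln_gt0 expn_gt0 B0 /K addn1.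
have CM : (C * B ^ 2 <= M)%N by rewrite leq_mul2r /K; apply/orP; right; lia.
have -> : (K * (16 * size (divisors T)) * B * tau (K * B ^ 2) ^ 8 =
   K * B * (16 * size (divisors T) * tau M ^ 8))%N by rewrite -/M; ring.
apply: (count_le_sigma (f := descent_key) _ (count_descent_target T0 M0 KM)).
move=> [[[[[[h1 h2] b3] k] G] L] j].
have [b30|b30] := posnP b3.
  exists (fun _ => (0%N, 0)); split.
    by move=> [[[[h1' h2'] h3'] [[b1' b2'] b3']] k'] [[_ [_ _ + _] _ _ _] _] [_ _ e]; rewrite e b30.
  by move=> [[[[h1' h2'] h3'] [[b1' b2'] b3']] k'] t' [[_ [_ _ + _] _ _ _] _] _ [_ _ e]; rewrite e b30.
(* The square of [G = gcd(b1, b2)] goes into the coefficients to make the point primitive. *)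
pose al := l1 * h1 * G%:Z ^+ 2; pose be := l2 * h2 * G%:Z ^+ 2.
pose E := (`|l3| * (2 * 2 ^ L))%N.
have m0 : (0 < b3 ^ 2)%N by rewrite expn_gt0 b30.
have j0 : (0 < 2 ^ j)%N by rewrite expn_gt0.
(* If this gcd condition fails, no datum has the given key, because the pairwise gcd conditions of
   the datum imply it. *)
have [gal|ngal] := boolP (gcdz al (b3 ^ 2)%N %| T'%:Z)%Z; last first.
  have no t : descent_eq l1 l2 l3 T C B t ->
      descent_key t = (h1, h2, b3, k, G, L, j) -> False.
    case: t => [[[[h1' h2'] h3'] [[b1 b2] b3']] k'] /= [_ _ _ [_ g13 _] _].
    move=> [eh1 _ eb3 _ eG _ _]; move/negP: ngal; apply.
    rewrite /gcdz dvdzE /= /al -mulrA abszM.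
    apply: dvdn_trans (dvdn_gcd_mull _ _ _) _; rewrite dvdn_mul //.
    apply: dvdn_trans g13; rewrite dvdn_gcd; apply/andP; split.
      apply: dvdn_trans (dvdn_gcdl _ _) _.
      by rewrite abszM abszX eh1 dvdn_mul // dvdn_exp2r // -eG dvdn_gcdl.
    by apply: dvdn_trans (dvdn_gcdr _ _) _; rewrite eb3 dvdn_mull.
  by exists (fun _ => (0%N, 0)); split => [t [/no h _] /h|t t' [/no h _] _ /h].
have [phi [phiP phiI]] := @admissible_embedding al be (b3 ^ 2)%N T' E (2 ^ j)%N m0 T'0 j0 gal.
pose red (t : descent_datum) := let: (_, _, _, (b1, b2, _), _) := t in (b1 %/ G, b2 %/ G)%N.
have redP t : descent_eq l1 l2 l3 T C B t -> descent_key t = (h1, h2, b3, k, G, L, j) ->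
    admissible al be (b3 ^ 2) T' E (2 ^ j) (red t).
  case: t => [[[[h1' h2'] h3] [[b1 b2] b3']] k'] /=.
  move=> [[h10 h20 h30] [b10 b20 _ k0] eq [_ g13 g23] _] [e1 e2 e3 e4 e5 e6 e7].
  rewrite {}e1 {}e2 {}e3 {}e4 in h10 h20 k0 eq g13 g23.
  have GU : (G %| b1)%N by rewrite -e5 dvdn_gcdl.
  have GV : (G %| b2)%N by rewrite -e5 dvdn_gcdr.
  have g0 : (0 < gcdn b1 b2)%N by rewrite gcdn_gt0 b10.
  have G0 : (0 < G)%N by rewrite -e5.
  have fE : form2 al be (b1 %/ G, b2 %/ G)%N = - (l3 * h3) * (b3 ^ 2)%N%:Z.
    apply: (@addIr _ (l3 * h3 * b3%:Z ^+ 2)); rewrite PoszX mulNr addNr -[RHS]eq.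
    congr (_ + _); rewrite /form2 /al /be /= -{2}(divnK GU) -{2}(divnK GV) !PoszM; ring.
  split => /=.
  - by rewrite -e5 coprime_divn_gcd.
  - rewrite -e7 e5; apply: trunc_log2_bounds.
    by rewrite divn_gt0 // dvdn_leq.
  - apply: (@dvdn_trans T); last by rewrite dvdn_mull.
    apply: dvdn_trans g13; rewrite dvdn_gcd; apply/andP; split.
      apply: dvdn_trans (dvdn_gcdl _ _) _.
      apply: (@dvdn_trans b1); first by rewrite -{2}(divnK GU) dvdn_mulr.
      by rewrite expnS dvdn_mull // dvdn_mulr.
    by apply: dvdn_trans (dvdn_gcdr _ _) _; rewrite dvdn_mull.
  - apply: (@dvdn_trans T); last by rewrite dvdn_mull.
    apply: dvdn_trans g23; rewrite dvdn_gcd; apply/andP; split.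
      apply: dvdn_trans (dvdn_gcdl _ _) _.
      apply: (@dvdn_trans b2); first by rewrite -{2}(divnK GV) dvdn_mulr.
      by rewrite expnS dvdn_mull // dvdn_mulr.
    by apply: dvdn_trans (dvdn_gcdr _ _) _; rewrite dvdn_mull.
  - split; first by rewrite fE dvdz_mull.
    rewrite fE -abszE -PoszM lez_nat abszM abszN abszM absz_nat mulnC leq_mul2l.
    rewrite /E -e6 leq_mul2l; apply/orP; right; apply/orP; right.
    by have /andP[_ /ltnW] := @trunc_log2_bounds `|h3| (eq_ind_r is_true h30 (absz_gt0 h3)).
exists (fun t => phi (red t)); split.
- move=> t [td tm] tk; have ta := redP _ td tk.
  have [] := phiP _ ta; case: (phi (red t)) => [d r] /= dd hr.
  case: t td tm tk {ta} => [[[[h1' h2'] h3] [[b1 b2] b3']] k'] /=.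
  move=> [[h10 h20 h30] [b10 b20 _ k0] _ [g12 _ _] [_ sz2 sz3]] [m1 m2] [e1 e2 e3 e4 e5 e6 e7].
  rewrite {}e1 {}e2 {}e3 {}e4 in h10 h20 k0 sz2 sz3 m1 m2 g12.
  have h1p : (0 < `|h1|)%N by rewrite absz_gt0.
  have h2p : (0 < `|h2|)%N by rewrite absz_gt0.
  have h3p : (0 < `|h3|)%N by rewrite absz_gt0.
  have k2p : (0 < k ^ 2)%N by rewrite expn_gt0 k0.
  have sp : (0 < `|h1| * `|h2| * `|h3| * k ^ 2)%N by rewrite muln_gt0 k2p andbT !muln_gt0 h1p h2p h3p.
  have G0 : (0 < G)%N by rewrite -e5 gcdn_gt0 b10.
  have L3 : (2 ^ L <= `|h3|)%N by rewrite -e6; have /andP[] := trunc_log2_bounds h3p.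
  have h3M : (`|h3| <= M)%N.
    apply: leq_trans CM; apply: (leq_mul_gt0r _ (leq_mul_gt0l sp sz3)).
    by rewrite expn_gt0 b30.
  have b2M : (b2 <= M)%N.
    apply: leq_trans CM; apply: (@leq_trans (b2 ^ 2)%N).
      by rewrite expnS expn1 leq_pmulr.
    exact: (leq_mul_gt0l h2p (leq_mul_gt0l sp sz2)).
  split => //; split.
  + apply: dvdn_trans g12; rewrite -e5 dvdn_gcd; apply/andP; split.
      by rewrite expnS !(dvdn_mull, dvdn_mulr) // dvdn_gcdl.
    by rewrite expnS !(dvdn_mull, dvdn_mulr) // dvdn_gcdr.
  + exact: leq_trans L3 h3M.
  + apply: leq_trans b2M; apply: leq_trans (leq_div b2 G).
    rewrite -e7 e5 trunc_logP // divn_gt0 // dvdn_leq //.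
    by rewrite -e5 dvdn_gcdr.
  + split=> //; apply: leq_trans CM.
    exact: (leq_mul_gt0l h3p (leq_mul_gt0l sp sz3)).
  apply: (@descent_size _ _ `|h3| _ _ L _ C K B w) => //.
  * by rewrite /K; lia.
  * by rewrite /K addn1.
  apply: (@leq_trans (`|r| ^ 2 * `|(al * be)%R|)%N).
    have -> : (`|(al * be)%R| = `|h1| * `|h2| * (`|l1| * `|l2| * (G * G * (G * G))))%N.
      by rewrite /al /be expr2 !abszM absz_nat; ring.
    rewrite leq_mul2l leq_pmulr ?orbT // !muln_gt0 G0 !absz_gt0 l10 l20 //.
  rewrite -lez_nat -abszX PoszM [`|_ ^+ 2|%N%:Z]abszE [`|_ ^+ 2|]ger0_norm ?sqr_ge0 // abszE.
  apply: le_trans hr _; rewrite -!PoszX -!PoszM lez_nat /w /E.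
  by apply: eq_leq; ring.
- move=> t t' [td _] [td' _] tk tk' e.
  have er := phiI _ _ (redP _ td tk) (redP _ td' tk') e.
  move: er td td' tk tk'.
  case: t {e} => [[[[a1 a2] a3] [[c1 c2] c3]] k1].
  case: t' => [[[[a1' a2'] a3'] [[c1' c2'] c3']] k1'] /= [er1 er2].
  move=> [_ _ eq _ _] [_ _ eq' _ _] [e1 e2 e3 e4 e5 _ _] [f1 f2 f3 f4 f5 _ _].
  have c1E : c1 = c1'.
    have Gc : (G %| c1)%N by rewrite -e5 dvdn_gcdl.
    have Gc' : (G %| c1')%N by rewrite -f5 dvdn_gcdl.
    by rewrite -(divnK Gc) er1 divnK.
  have c2E : c2 = c2'.
    have Gc : (G %| c2)%N by rewrite -e5 dvdn_gcdr.
    have Gc' : (G %| c2')%N by rewrite -f5 dvdn_gcdr.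
    by rewrite -(divnK Gc) er2 divnK.
  rewrite e1 e2 e3 e4 f1 f2 f3 f4 in eq eq' *.
  (* With all other entries known, the descent equation is linear in [h3] with nonzero
     coefficient. *)
  suff -> : a3 = a3' by rewrite c1E c2E.
  have nz : l3 * b3%:Z ^+ 2 != 0 by rewrite mulf_neq0 // expf_neq0 // eqz_nat -lt0n.
  apply: (mulIf nz); rewrite -c1E -c2E in eq'.
  apply: (@addrI _ (l1 * h1 * c1%:Z ^+ 2 + l2 * h2 * c2%:Z ^+ 2)).
  by transitivity (0 : int); [rewrite -eq | rewrite -eq']; ring.
Qed.

(** The descent equation is symmetric under simultaneous permutations of the indices, so the largest
    [|h_i|] can be moved to the third place. *)
Lemma count_descent (l1 l2 l3 : int) (T C : nat) :
  l1 != 0 -> l2 != 0 -> l3 != 0 -> (0 < T)%N ->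
  exists c K : nat, (0 < K)%N /\ forall B : nat, (0 < B)%N ->
  count_le (descent_eq l1 l2 l3 T C B) (c * B * tau (K * B ^ 2) ^ 8).
Proof.
move=> l10 l20 l30 T0.
have [c3 [K3 [K30 H3]]] := count_descent_max3 C l10 l20 l30 T0.
have [c1 [K1 [K10 H1]]] := count_descent_max3 C l20 l30 l10 T0.
have [c2 [K2 [K20 H2]]] := count_descent_max3 C l10 l30 l20 T0.
exists (c3 + c1 + c2)%N, (K3 + K1 + K2)%N; split; first by lia.
move=> B B0; set M := ((K3 + K1 + K2) * B ^ 2)%N.
have wk (c K : nat) : (K <= K3 + K1 + K2)%N ->
    (c * B * tau (K * B ^ 2) ^ 8 <= c * B * tau M ^ 8)%N.
  by move=> KK; rewrite leq_mul2l leq_exp2r // leq_tau ?orbT // leq_mul2r KK orbT.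
have {}H3 := count_le_weaken (H3 B B0) (wk c3 _ (_ : (K3 <= _)%N)).
have {}H1 := count_le_weaken (H1 B B0) (wk c1 _ (_ : (K1 <= _)%N)).
have {}H2 := count_le_weaken (H2 B B0) (wk c2 _ (_ : (K2 <= _)%N)).
have -> : ((c3 + c1 + c2) * B * tau M ^ 8 =
  c3 * B * tau M ^ 8 + c1 * B * tau M ^ 8 + c2 * B * tau M ^ 8)%N by ring.
pose mx (i j k : descent_datum -> int) (t : descent_datum) :=
  (`|i t| <= `|k t|)%N /\ (`|j t| <= `|k t|)%N.
pose p1 (t : descent_datum) := t.1.1.1.1; pose p2 (t : descent_datum) := t.1.1.1.2.
pose p3 (t : descent_datum) := t.1.1.2.
apply: (count_le_sub (Q := fun t =>
  ((descent_eq l1 l2 l3 T C B t /\ mx p1 p2 p3 t) \/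
   (descent_eq l1 l2 l3 T C B t /\ mx p2 p3 p1 t)) \/
   (descent_eq l1 l2 l3 T C B t /\ mx p1 p3 p2 t))).
  move=> [[[[h1 h2] h3] [[b1 b2] b3]] k] td.
  have : mx p1 p2 p3 (h1, h2, h3, (b1, b2, b3), k) \/
    mx p2 p3 p1 (h1, h2, h3, (b1, b2, b3), k) \/ mx p1 p3 p2 (h1, h2, h3, (b1, b2, b3), k).
    by rewrite /mx /=; lia.
  by move=> [?|[?|?]]; [left; left | left; right | right].
apply: count_le_or; first apply: count_le_or.
- apply: count_le_sub (H3 _); last by lia.
  by move=> [[[[h1 h2] h3] [[b1 b2] b3]] k].
- apply: (count_le_inj (f := fun t : descent_datum =>
    let: (h1, h2, h3, (b1, b2, b3), k) := t in
    (h2, h3, h1, (b2, b3, b1), k) : descent_datum) _ _ (H1 _)); last by lia.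
    move=> [[[[h1 h2] h3] [[b1 b2] b3]] k] /=.
    move=> [[[? ? ?] [? ? ? ?] eq [? ? ?] [s1 s2 s3]] mm]; split; last exact: mm.
    split=> //; first by rewrite -eq; ring.
      by split=> //; rewrite gcdnC.
    have -> : (`|h2| * `|h3| * `|h1| = `|h1| * `|h2| * `|h3|)%N by ring.
    by split.
  by move=> [[[[? ?] ?] [[? ?] ?]] ?] [[[[? ?] ?] [[? ?] ?]] ?] _ _ [-> -> -> -> -> -> ->].
- apply: (count_le_inj (f := fun t : descent_datum =>
    let: (h1, h2, h3, (b1, b2, b3), k) := t in
    (h1, h3, h2, (b1, b3, b2), k) : descent_datum) _ _ (H2 _)); last by lia.
    move=> [[[[h1 h2] h3] [[b1 b2] b3]] k] /=.
    move=> [[[? ? ?] [? ? ? ?] eq [? ? ?] [s1 s2 s3]] mm]; split; last exact: mm.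
    split=> //; first by rewrite -eq; ring.
      by split=> //; rewrite gcdnC.
    have -> : (`|h1| * `|h3| * `|h2| = `|h1| * `|h2| * `|h3|)%N by ring.
    by split.
  by move=> [[[[? ?] ?] [[? ?] ?]] ?] [[[[? ?] ?] [[? ?] ?]] ?] _ _ [-> -> -> -> -> -> ->].
Qed.

(** Squarefreeness of [h] takes the form in which the descent applies it: [h] dividing a square
    divides its root. A [z] violating this for [n] yields a square factor [e ^ 2 > 1] of [n], and
    induction applies to the quotient. *)
Lemma squarefree_decomposition (n : nat) : (0 < n)%N ->
  exists h b : nat, [/\ n = h * b ^ 2, 0 < b & forall z, h %| z ^ 2 -> h %| z]%N.
Proof.
elim/ltn_ind: n => n IH n0.
have [H|] := pselect (forall z, n %| z ^ 2 -> n %| z)%N.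
  by exists n, 1%N; rewrite muln1.
move=> /existsNP[z] /not_implyP[nz2 nz].
pose d := gcdn n z; have d0 : (0 < d)%N by rewrite gcdn_gt0 n0.
have [e ne] := dvdnP (dvdn_gcdl n z); have [y zy] := dvdnP (dvdn_gcdr n z).
rewrite -/d in ne zy.
have cop : coprime e y.
  have : (gcdn (e * d) (y * d) = d)%N by rewrite -ne -zy.
  by rewrite -muln_gcdl -{2}[d]mul1n => /eqP; rewrite eqn_pmul2r.
(* From [n = e * d] dividing [z ^ 2 = y ^ 2 * d ^ 2] it follows that [e] divides [y ^ 2 * d], and
   [e] is prime to [y]. *)
have ed : (e %| d)%N.
  have : (e * d %| (y ^ 2 * d) * d)%N.
    by rewrite -ne -mulnA mulnn -expnMn -zy.
  by rewrite dvdn_pmul2r // Gauss_dvdr // coprimeXr.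
have [c dc] := dvdnP ed.
have e1 : (1 < e)%N.
  rewrite ltn_neqAle eq_sym; apply/andP; split; last first.
    by rewrite lt0n; apply: contraTneq n0 => e0; rewrite ne e0.
  apply/eqP => e1; case: nz; have -> : n = d by rewrite ne e1 mul1n.
  exact: dvdn_gcdr.
have nE : (n = c * e ^ 2)%N by rewrite ne dc; ring.
have c0 : (0 < c)%N by move: n0; rewrite nE muln_gt0 => /andP[].
have cn : (c < n)%N by rewrite nE ltn_Pmulr // -(exp1n 2) ltn_sqr.
have [h [b [cE b0 hP]]] := IH c cn c0.
exists h, (b * e)%N; split => //; last by rewrite muln_gt0 b0 ltnW.
by rewrite nE cE expnMn mulnA.
Qed.

Lemma squarefree_decompositionz (a : int) : a != 0 ->
  exists (h : int) (b : nat), [/\ a = h * b%:Z ^+ 2, (0 < b)%N &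
    forall z : nat, (`|h| %| z ^ 2 -> `|h| %| z)%N].
Proof.
move=> a0; have [|h [b [aE b0 hP]]] := @squarefree_decomposition `|a|%N.
  by rewrite absz_gt0.
exists (Num.sg a * h%:Z), b; split => //.
  by rewrite -mulrA -PoszX -PoszM -aE abszE mulr_sg_norm.
by move=> z; rewrite abszM absz_sg a0 mul1n; apply: hP.
Qed.

Lemma dvdn_gcd_mul2 (a b c : nat) : (gcdn (a * b) c %| gcdn a c * gcdn b c)%N.
Proof.
rewrite muln_gcdl dvdn_gcd dvdn_gcd_mull /=.
by rewrite dvdn_mulr // dvdn_gcdr.
Qed.

(** Replace a product by lcm times gcd twice: the lcm of all three divides [z], and the gcd of
    [lcm(h1, h2)] with [h3] divides [t13 * t23]. *)
Lemma dvdn_mul3_gcd (h1 h2 h3 z t12 t13 t23 : nat) :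
  (gcdn h1 h2 %| t12 -> gcdn h1 h3 %| t13 -> gcdn h2 h3 %| t23 ->
   h1 %| z -> h2 %| z -> h3 %| z -> h1 * h2 * h3 %| t12 * t13 * t23 * z)%N.
Proof.
move=> g12 g13 g23 z1 z2 z3.
rewrite -(muln_lcm_gcd h1 h2); set l := lcmn h1 h2.
have lz : (l %| z)%N by rewrite dvdn_lcm z1.
rewrite mulnAC -(muln_lcm_gcd l h3).
have lz3 : (lcmn l h3 %| z)%N by rewrite dvdn_lcm lz.
have -> : (t12 * t13 * t23 * z = z * (t13 * t23) * t12)%N by ring.
rewrite dvdn_mul // dvdn_mul //.
apply: dvdn_trans (dvdn_mul g13 g23); apply: dvdn_trans (dvdn_gcd_mul2 h1 h2 h3).
rewrite dvdn_gcd dvdn_gcdr andbT; apply: dvdn_trans (dvdn_gcdl _ _) _.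
by rewrite dvdn_lcm dvdn_mulr // dvdn_mull.
Qed.

(** * Descent on the surface *)

Lemma leq_absz_sub (a b : int) : (`|(a - b)%R| <= `|a| + `|b|)%N.
Proof. lia. Qed.

(** A Bezout relation between [x] and [q] expresses [e - f] as a combination of the two linear
    forms. *)
Lemma dvdn_gcd_linear (x q e f : int) : coprimez x q ->
  (gcdn `|(x - e * q)%R| `|(x - f * q)%R| %| `|(e - f)%R|)%N.
Proof.
move=> cop; set d := gcdn _ _.
have d1 : (d%:Z %| x - e * q)%Z by rewrite dvdzE dvdn_gcdl.
have d2 : (d%:Z %| x - f * q)%Z by rewrite dvdzE dvdn_gcdr.
have [[u v] /= uv] := coprimezP _ _ cop.
suff : (d%:Z %| e - f)%Z by rewrite dvdzE.
have -> : e - f = (u * e + v) * (x - f * q) - (u * f + v) * (x - e * q).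
  rewrite -[LHS]mul1r -uv; ring.
by rewrite rpredB // dvdz_mull.
Qed.

Definition descent_of (e1 e2 : int) (T : nat) (w : int * int) (t : descent_datum) : Prop :=
  let: (h1, h2, h3, (b1, b2, b3), k) := t in
  T%:Z ^+ 2 * (w.1 - e1 * w.2) = (`|h1| * `|h2| * `|h3| * k ^ 2)%N%:Z * (h1 * b1%:Z ^+ 2) /\
  T%:Z ^+ 2 * (w.1 - e2 * w.2) = (`|h1| * `|h2| * `|h3| * k ^ 2)%N%:Z * (h2 * b2%:Z ^+ 2).

Lemma descent_of_inj (e1 e2 : int) (T : nat) (w w' : int * int) (t : descent_datum) :
  e1 != e2 -> (0 < T)%N -> descent_of e1 e2 T w t -> descent_of e1 e2 T w' t -> w = w'.
Proof.
move=> e12 T0; case: t => [[[[h1 h2] h3] [[b1 b2] b3]] k] /= [i1 i2] [j1 j2].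
have T2 : T%:Z ^+ 2 != 0 by rewrite expf_neq0 // eqz_nat -lt0n.
have a1 := mulfI T2 (etrans i1 (esym j1)).
have a2 := mulfI T2 (etrans i2 (esym j2)).
case: w w' {i1 i2 j1 j2} a1 a2 => [x q] [x' q'] /= a1 a2.
have d0 : e2 - e1 != 0 by rewrite subr_eq0 eq_sym.
have qq : q = q'.
  apply: (mulfI d0).
  have -> : (e2 - e1) * q = (x - e1 * q) - (x - e2 * q) by ring.
  by rewrite a1 a2; ring.
by rewrite qq in a1 *; move/addIr: a1 => ->.
Qed.

(** With [g = gcd(x, q)] and [(x - e_i q) / g = h_i b_i ^ 2], the equation reads
    [y ^ 2 = g * s * (g * b1 * b2 * b3) ^ 2] for [s = |h1 * h2 * h3|], so [g * s] is a square
    [z ^ 2]. *)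
Lemma descent_exists (e1 e2 e3 : int) (c B : nat) (x q y : int) :
  e1 != e2 -> e1 != e3 -> e2 != e3 ->
  q != 0 -> y != 0 -> y ^+ 2 = (x - e1 * q) * (x - e2 * q) * (x - e3 * q) ->
  (`|(x - e1 * q)%R| <= c * B ^ 2)%N -> (`|(x - e2 * q)%R| <= c * B ^ 2)%N ->
  (`|(x - e3 * q)%R| <= c * B ^ 2)%N ->
  let T := (`|(e1 - e2)%R| * `|(e1 - e3)%R| * `|(e2 - e3)%R|)%N in
  exists t, descent_eq (e2 - e3) (e3 - e1) (e1 - e2) T (T ^ 2 * c) B t /\
            descent_of e1 e2 T (x, q) t.
Proof.
move=> e12 e13 e23 q0 y0 eq sz1 sz2 sz3 T.
have T0 : (0 < T)%N by rewrite !muln_gt0 !absz_gt0 !subr_eq0 e12 e13 e23.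
pose g := gcdn `|x| `|q|.
have g0 : (0 < g)%N by rewrite gcdn_gt0 !absz_gt0 q0 orbT.
have gz0 : g%:Z != 0 by rewrite eqz_nat -lt0n.
have /dvdzP[x' xE] : (g%:Z %| x)%Z by rewrite dvdzE dvdn_gcdl.
have /dvdzP[q' qE] : (g%:Z %| q)%Z by rewrite dvdzE dvdn_gcdr.
have cop : coprimez x' q'.
  have : (gcdn (`|x'| * g) (`|q'| * g) = g)%N.
    have -> : (`|x'| * g = `|x|)%N by rewrite [in RHS]xE abszM.
    by have -> : (`|q'| * g = `|q|)%N by rewrite [in RHS]qE abszM.
  by rewrite -muln_gcdl -{2}[g]mul1n => /eqP; rewrite eqn_pmul2r.
have aE e : x - e * q = (x' - e * q') * g%:Z by rewrite xE qE; ring.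
rewrite !aE in eq sz1 sz2 sz3.
move: (dvdn_gcd_linear e1 e2 cop) (dvdn_gcd_linear e1 e3 cop) (dvdn_gcd_linear e2 e3 cop).
have lin : (e2 - e3) * (x' - e1 * q') + (e3 - e1) * (x' - e2 * q')
   + (e1 - e2) * (x' - e3 * q') = 0 by ring.
have nz : (x' - e1 * q') * (x' - e2 * q') * (x' - e3 * q') != 0.
  apply: contra_neq y0 => z0; apply/eqP; rewrite -sqrf_eq0 eq.
  have -> : (x' - e1 * q') * g%:Z * ((x' - e2 * q') * g%:Z) * ((x' - e3 * q') * g%:Z) =
    (x' - e1 * q') * (x' - e2 * q') * (x' - e3 * q') * g%:Z ^+ 3 by ring.
  by rewrite z0 mul0r.
have /andP[/andP[]] : (x' - e1 * q' != 0) && (x' - e2 * q' != 0) && (x' - e3 * q' != 0).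
  by move: nz; rewrite !mulf_eq0 !negb_or.
rewrite /descent_of /= !aE.
move: (x' - e1 * q') (x' - e2 * q') (x' - e3 * q') eq sz1 sz2 sz3 lin {nz}.
move=> a1 a2 a3 eq sz1 sz2 sz3 lin a10 a20 a30 g12 g13 g23.
have [h1 [b1 [a1E b10 sq1]]] := squarefree_decompositionz a10.
have [h2 [b2 [a2E b20 sq2]]] := squarefree_decompositionz a20.
have [h3 [b3 [a3E b30 sq3]]] := squarefree_decompositionz a30.
have abE (a h : int) (b : nat) : a = h * b%:Z ^+ 2 -> (`|a| = `|h| * b ^ 2)%N.
  by move=> ->; rewrite abszM abszX.
have hn0 (a h : int) (b : nat) : a != 0 -> a = h * b%:Z ^+ 2 -> h != 0.
  by move=> an0 ae; apply: contraNneq an0 => h0; rewrite ae h0 mul0r.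
have h10 := hn0 _ _ _ a10 a1E; have h20 := hn0 _ _ _ a20 a2E.
have h30 := hn0 _ _ _ a30 a3E.
have gh (a h a' h' : int) (b b' t : nat) : a = h * b%:Z ^+ 2 -> a' = h' * b'%:Z ^+ 2 ->
    (gcdn `|a| `|a'| %| t -> gcdn `|h| `|h'| %| t)%N.
  move=> /abE -> /abE ->; apply: dvdn_trans; rewrite dvdn_gcd.
  apply/andP; split; rewrite dvdn_mulr // ?dvdn_gcdl // dvdn_gcdr //.
pose s := (`|h1| * `|h2| * `|h3|)%N.
have s0 : (0 < s)%N by rewrite !muln_gt0 !absz_gt0 h10 h20 h30.
have [z zE] : exists z : nat, (z ^ 2 = g * s)%N.
  have bb0 : (0 < g * (b1 * b2 * b3))%N by rewrite !muln_gt0 g0 b10 b20 b30.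
  have yE : (`|y| ^ 2 = (g * s) * (g * (b1 * b2 * b3)) ^ 2)%N.
    rewrite -abszX eq !abszM (abE _ _ _ a1E) (abE _ _ _ a2E) (abE _ _ _ a3E) !absz_nat /s.
    ring.
  have /dvdnP[z zE] : (g * (b1 * b2 * b3) %| `|y|)%N.
    by rewrite -(@dvdn_pexp2r _ _ 2) // yE dvdn_mull.
  exists z; apply/eqP; rewrite -(@eqn_pmul2r ((g * (b1 * b2 * b3)) ^ 2)%N).
    by rewrite -expnMn -zE yE.
  by rewrite expn_gt0 bb0.
(* Each [h_i] divides [z ^ 2], hence [z]. Their pairwise gcds divide the differences of the [e_i],
   whose product is [T], so [s] divides [T * z]. Squaring then gives [T ^ 2 * g = s * k ^ 2]. *)
have [k kE] : exists k : nat, (T * z = k * s)%N.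
  apply/dvdnP; rewrite /s /T; apply: dvdn_mul3_gcd.
  - exact: gh a1E a2E g12.
  - exact: gh a1E a3E g13.
  - exact: gh a2E a3E g23.
  - by apply: sq1; rewrite zE /s -mulnA dvdn_mull // dvdn_mulr.
  - by apply: sq2; rewrite zE /s dvdn_mull // dvdn_mulr // dvdn_mull.
  - by apply: sq3; rewrite zE /s dvdn_mull // dvdn_mull.
have Tg : (T ^ 2 * g = s * k ^ 2)%N.
  apply/eqP; rewrite -(@eqn_pmul2r s) //; apply/eqP.
  have -> : (s * k ^ 2 * s = (k * s) ^ 2)%N by ring.
  by rewrite -kE -mulnA -zE expnMn.
have k0 : (0 < k)%N.
  rewrite lt0n; apply: contraTneq (s0) => k0; move: Tg; rewrite k0 exp0n // muln0.
  by move/eqP; rewrite muln_eq0 expn_eq0 !eqn0Ngt T0 g0.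
have gT (i j : int) (n : nat) : (gcdn `|i| `|j| %| n -> n %| T -> gcdn `|i| `|j| %| T)%N.
  by move=> h; apply: dvdn_trans.
have size_ok (a h : int) (b : nat) : a = h * b%:Z ^+ 2 -> (`|(a * g%:Z)%R| <= c * B ^ 2)%N ->
    (s * k ^ 2 * (`|h| * b ^ 2) <= T ^ 2 * c * B ^ 2)%N.
  move=> ae; rewrite abszM (abE _ _ _ ae) absz_nat -Tg => h1'.
  by rewrite -[(T ^ 2 * c * _)%N]mulnA -[(T ^ 2 * g * _)%N]mulnA leq_mul2l [(g * _)%N]mulnC h1' orbT.
exists (h1, h2, h3, (b1, b2, b3), k); split.
  split => //; first by rewrite -[RHS]lin a1E a2E a3E; ring.
  - rewrite -(abE _ _ _ a1E) -(abE _ _ _ a2E) -(abE _ _ _ a3E); split.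
    + by apply: dvdn_trans g12 _; rewrite /T -mulnA dvdn_mulr.
    + by apply: dvdn_trans g13 _; rewrite /T dvdn_mulr // dvdn_mull.
    + by apply: dvdn_trans g23 _; rewrite /T dvdn_mull.
  - by split; [apply: size_ok a1E sz1 | apply: size_ok a2E sz2 | apply: size_ok a3E sz3].
rewrite -/s -Tg PoszM PoszX -a1E -a2E; split; ring.
Qed.

Definition surface_pair (e1 e2 e3 : int) (c B : nat) (w : int * int) : Prop :=
  [/\ w.2 != 0, exists2 y : int, y != 0 &
      y ^+ 2 = (w.1 - e1 * w.2) * (w.1 - e2 * w.2) * (w.1 - e3 * w.2),
      (`|w.1| <= c * B ^ 2)%N & (`|w.2| <= c * B ^ 2)%N].

Lemma count_surface_pair (e1 e2 e3 : int) (c : nat) :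
  e1 != e2 -> e1 != e3 -> e2 != e3 ->
  exists c0 K : nat, (0 < K)%N /\ forall B : nat, (0 < B)%N ->
  count_le (surface_pair e1 e2 e3 c B) (c0 * B * tau (K * B ^ 2) ^ 8).
Proof.
move=> e12 e13 e23.
pose T := (`|(e1 - e2)%R| * `|(e1 - e3)%R| * `|(e2 - e3)%R|)%N.
have T0 : (0 < T)%N by rewrite !muln_gt0 !absz_gt0 !subr_eq0 e12 e13 e23.
pose c' := (c * (1 + `|e1| + `|e2| + `|e3|))%N.
have [||||c0 [K [K0 H]]] := @count_descent (e2 - e3) (e3 - e1) (e1 - e2) T (T ^ 2 * c').
- by rewrite subr_eq0.
- by rewrite subr_eq0 eq_sym.
- by rewrite subr_eq0.
- exact: T0.
exists c0, K; split=> // B B0.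
have /choice[f fP] : forall w, exists t, surface_pair e1 e2 e3 c B w ->
    descent_eq (e2 - e3) (e3 - e1) (e1 - e2) T (T ^ 2 * c') B t /\ descent_of e1 e2 T w t.
  move=> [x q]; have [sp|nsp] := pselect (surface_pair e1 e2 e3 c B (x, q)); last first.
    by exists (0, 0, 0, (0%N, 0%N, 0%N), 0%N).
  case: sp => /= q0 [y y0 eq] xB qB.
  have sz e : (`|e| <= `|e1| + `|e2| + `|e3|)%N -> (`|(x - e * q)%R| <= c' * B ^ 2)%N.
    move=> eb; apply: (@leq_trans (`|x| + `|e| * `|q|)%N).
      by rewrite -abszM leq_absz_sub.
    have h1 := leq_mul eb qB.
    apply: leq_trans (leq_add xB h1) _.
    by apply: eq_leq; rewrite /c'; ring.
  have [|||t tP] := descent_exists e12 e13 e23 q0 y0 eq (c := c') (B := B).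
  - by apply: sz; rewrite -addnA leq_addr.
  - by apply: sz; rewrite addnAC leq_addl.
  - by apply: sz; rewrite leq_addl.
  by exists t => _; exact: tP.
apply: (count_le_inj (f := f) _ _ (H B B0)).
  by move=> w /fP[].
move=> w w' /fP[_ d] /fP[_ d'] e; rewrite -e in d'.
exact: (descent_of_inj e12 T0 d d').
Qed.

Definition int_point (e1 e2 e3 a b c : int) (B : nat) (t : int * int * int * int) : Prop :=
  let: (y, x, u, v) := t in
  let q := bq a b c u v in
  [/\ y != 0, q != 0, y ^+ 2 = (x - e1 * q) * (x - e2 * q) * (x - e3 * q),
      (`|x| <= B ^ 2)%N & (`|u| <= B)%N /\ (`|v| <= B)%N].

(** Project first to [(x, q)], which gives [B * tau ^ 8], then to [(u, v)] with [Q(u,v) = q], which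
    gives [tau ^ 3]; [y] is then known up to sign. *)
Lemma count_int_point (e1 e2 e3 a b c : int) :
  e1 != e2 -> e1 != e3 -> e2 != e3 -> b ^+ 2 - 4 * a * c != 0 ->
  exists c0 K : nat, (0 < K)%N /\ forall B : nat, (0 < B)%N ->
  count_le (int_point e1 e2 e3 a b c B) (c0 * B * tau (K * B ^ 2) ^ 11).
Proof.
move=> e12 e13 e23 D0.
have [c1 [K1 [K10 H1]]] := count_bq D0.
pose s := (`|a| + `|b| + `|c|).+1.
have [c2 [K2 [K20 H2]]] := count_surface_pair s e12 e13 e23.
exists (c2 * c1 * 2)%N, (K1 + K2)%N; split; first by rewrite addn_gt0 K10.
move=> B B0; set M := ((K1 + K2) * B ^ 2)%N.
have -> : (c2 * c1 * 2 * B * tau M ^ 11 = c2 * B * tau M ^ 8 * (c1 * tau M ^ 3 * 2))%N by ring.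
have {}H2 : count_le (surface_pair e1 e2 e3 s B) (c2 * B * tau M ^ 8).
  apply: count_le_weaken (H2 B B0) _.
  by rewrite leq_mul2l leq_exp2r // leq_tau ?orbT // leq_mul2r leq_addl orbT.
have {}H1 q : q != 0 -> count_le (fun w : int * int => bq a b c w.1 w.2 = q /\
    (`|w.1| <= B)%N /\ (`|w.2| <= B)%N) (c1 * tau M ^ 3).
  move=> q0; apply: count_le_weaken (H1 q B B0 q0) _.
  by rewrite leq_mul2l leq_exp2r // leq_tau ?orbT // leq_mul2r leq_addr orbT.
apply: (count_le_fiber (f := fun t : int * int * int * int =>
   (t.1.1.2, bq a b c t.1.2 t.2)) _ H2).
  move=> [[[y x] u] v] /= [y0 q0 eq xB [uB vB]]; split => //=.
  - by exists y.
  - by apply: leq_trans xB _; rewrite leq_pmull.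
  - by apply: leq_trans (leq_bq a b c uB vB) _; rewrite leq_mul2r leqnSn orbT.
move=> [x0 q]; have [->|q0] := eqVneq q 0.
  by move=> [|[[[y x] u] v] l] // _ /(_ _ (mem_head _ _)) /= [[_ /eqP + _ _ _] [_ h]].
apply: (count_le_fiber (f := fun t : int * int * int * int => (t.1.2, t.2)) _ (H1 q q0)).
  by move=> [[[y x] u] v] /= [[_ _ _ _ h] [_ ->]].
move=> [u0 v0].
have [[[[[y0 x] u] v] /= [[[_ _ eq0 _ _] [ex eq]] [eu ev]]]|nt] :=
    pselect (exists t, (int_point e1 e2 e3 a b c B t /\
     (t.1.1.2, bq a b c t.1.2 t.2) = (x0, q)) /\ (t.1.2, t.2) = (u0, v0)); last first.
  by move=> [|t l] // _ tP; case: nt; exists t; apply: tP; rewrite mem_head.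
have one : count_le (fun z : int => `|z|%N = `|y0|%N) (1 * 2).
  apply: (count_le_absz (P := fun k => k = `|y0|%N)).
  by apply: (@count_le_seq _ _ [:: `|y0|%N]) => k ->; rewrite mem_head.
apply: (count_le_inj (f := fun t : int * int * int * int => t.1.1.1) _ _ one).
  move=> [[[y x'] u'] v'] /= [[[_ _ eq' _ _] [ex' eq'']] _].
  have /eqP : y ^+ 2 = y0 ^+ 2 by rewrite eq' eq0 eq'' eq ex ex'.
  by rewrite eqf_sqr => /orP[/eqP->|/eqP->] //; rewrite abszN.
move=> [[[y1 x1] u1] v1] [[[y2 x2] u2] v2] /=.
by move=> [[_ [-> _]] [-> ->]] [[_ [-> _]] [-> ->]] ->.
Qed.

(** * Rational points *)

(** If the discriminant vanishes, [(b, -2a)] lies in the radical; it is therefore zero, and then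
    [(1, 0)] lies in the radical as well. *)
Lemma disc_neq0 (Q : binary_form) : nondegenerate_form Q ->
  bf_uv Q ^+ 2 - 4 * bf_uu Q * bf_vv Q != 0.
Proof.
move=> nd; apply/eqP => D0.
pose a : rat := (bf_uu Q)%:~R; pose b : rat := (bf_uv Q)%:~R; pose c : rat := (bf_vv Q)%:~R.
have D0' : b ^+ 2 = 4 * a * c.
  apply/eqP; rewrite -subr_eq0 /a /b /c; apply/eqP.
  by rewrite -[RHS](mulr0z 1) -D0 rmorphB rmorphXn !rmorphM.
have polE (w w' : rat * rat) : bf_polar Q w w' =
    (2 * a * w.1 + b * w.2) * w'.1 + (b * w.1 + 2 * c * w.2) * w'.2.
  by rewrite /bf_polar /bf_eval /= -/a -/b -/c; ring.
have ker w1 w2 : 2 * a * w1 + b * w2 = 0 -> b * w1 + 2 * c * w2 = 0 -> (w1, w2) = 0.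
  by move=> h1 h2; apply: nd => w'; rewrite polE /= h1 h2 !mul0r addr0.
have [] : (b, - (2 * a)) = 0 :> rat * rat.
  by apply: ker; [ring | rewrite -expr2 D0'; ring].
move=> b0 /eqP; rewrite oppr_eq0 mulf_eq0 /= => /eqP a0.
have [/eqP] : (1, 0) = 0 :> rat * rat.
  by apply: ker; rewrite ?a0 ?b0; ring.
by rewrite oner_eq0.
Qed.

Lemma counting_le (R : realType) (T : choiceType) (A : set T) (n : nat) :
  count_le A n -> (counting A <= (n%:R : R)%:E)%E.
Proof.
move=> H; rewrite /counting; case: asboolP => [fA|nA].
  rewrite lee_fin ler_nat; apply: H; first exact: finmap.fset_uniq.
  by move=> x; rewrite in_fset_set // inE.
have [S SA] := infinite_set_fset n.+1 nA.
rewrite leqNgt ltnS => /negP[]; apply: H; first exact: finmap.fset_uniq.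
by move=> x xS; apply: SA.
Qed.

(** The [k]-th root of the divisor bound; taking [k] large makes the exponent of [B] as small as
    desired. *)
Lemma tau_powR (R : realType) (K j k n : nat) : (0 < K)%N -> (0 < k)%N ->
  exists2 A : R, 0 <= A & forall B : nat, (0 < B)%N ->
    (tau (K * B ^ j) ^ n)%N%:R <= A * B%:R `^ ((j * n)%:R / k%:R).
Proof.
move=> K0 k0; set c := ((k ^ k) ^ (2 ^ k) * K)%N.
have kR : k%:R != 0 :> R by rewrite pnatr_eq0 -lt0n.
exists ((c ^ n)%N%:R `^ (k%:R^-1)); first exact: powR_ge0.
move=> B B0; set t := tau _.
have h : ((t ^ n) ^ k <= c ^ n * B ^ (j * n))%N.
  rewrite -expnM mulnC !expnM -expnMn.
  have le : (t ^ k <= c * B ^ j)%N.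
    by rewrite /c -mulnA; apply: tau_pow => //; rewrite muln_gt0 K0 expn_gt0 B0.
  by case: (n) => // n'; rewrite leq_exp2r.
have -> : (t ^ n)%N%:R = ((t ^ n) ^ k)%N%:R `^ (k%:R^-1) :> R.
  by rewrite [in RHS]natrX -powR_mulrn ?ler0n // -powRrM mulfV // powRr1 ?ler0n.
have -> : B%:R `^ ((j * n)%:R / k%:R) = (B ^ (j * n))%N%:R `^ (k%:R^-1) :> R.
  by rewrite powRrM powR_mulrn ?ler0n // natrX.
rewrite -powRM ?ler0n // -natrM.
by apply: ge0_ler_powR; rewrite ?nnegrE ?invr_ge0 ?ler0n // ler_nat.
Qed.

Lemma openU_int_point (R : realType) (e1 e2 e3 : int) (Q : binary_form) (B : R)
    (P : wproj) (t : quad int) :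
  1 <= B -> openU e1 e2 e3 Q P -> primitive_rep P t -> height R P <= B ->
  int_point e1 e2 e3 (bf_uu Q) (bf_uv Q) (bf_vv Q) (Num.truncn B).+1 t.
Proof.
move=> B1 UP tP; rewrite (heightE R tP).
case: tP => _ [s sE sP]; move: UP; rewrite -sP => /openU_pi; rewrite sE.
case: t {sE} => [[[y x] u] v] /=.
set q := bq (bf_uu Q) (bf_uv Q) (bf_vv Q) u v.
have -> : bf_eval Q (u%:~R, v%:~R) = q%:~R.
  by rewrite /bf_eval /q /bq /=; ring.
move=> [eq y0 q0]; rewrite !ge_max => /andP[/andP[_ hx] /andP[hu hv]].
have Bt : B < (Num.truncn B).+1%:R by exact: truncnS_gt.
have natz (z : int) (m : nat) : `|z%:~R| <= m%:R :> R -> (`|z| <= m)%N.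
  by rewrite -intr_norm -abszE -pmulrn ler_nat.
have B0 : 0 <= B by apply: le_trans B1.
split.
- by apply/eqP => y00; apply: y0; rewrite y00.
- by apply/eqP => q00; apply: q0; rewrite q00.
- by apply: (@intr_inj rat); rewrite rmorphXn /= eq; ring.
- apply: natz; rewrite natrX.
  have -> : `|x%:~R| = (`|x%:~R| `^ 2%:R^-1) ^+ 2 :> R.
    by rewrite -powR_mulrn ?powR_ge0 // -powRrM mulVf ?pnatr_eq0 // powRr1.
  rewrite ler_sqr ?nnegrE ?powR_ge0 ?ler0n //.
  exact: le_trans hx (ltW Bt).
- by split; apply: natz; [apply: le_trans hu (ltW Bt) | apply: le_trans hv (ltW Bt)].
Qed.

Theorem theorem1 (R : realType) (e1 e2 e3 : int) (Q : binary_form)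
    (he12 : e1 <> e2) (he13 : e1 <> e3) (he23 : e2 <> e3)
    (hQ : nondegenerate_form Q) :
  forall eps : R, 0 < eps ->
    exists C : R, forall B : R, 1 <= B ->
      (counting_function (openU e1 e2 e3 Q) B <= (C * B `^ (1 + eps))%:E)%E.
Proof.
move=> eps eps0.
have [c [K [K0 H]]] := count_int_point (introN eqP he12) (introN eqP he13)
  (introN eqP he23) (disc_neq0 hQ).
(* Here [22 = 2 * 11]: the eleventh power of [tau] is taken at an argument quadratic in the height
   bound. *)
pose k := (Num.truncn (22 / eps)).+1.
have kR : 0 < k%:R :> R by rewrite ltr0n.
have keps : (2 * 11)%N%:R / k%:R <= eps.
  by rewrite ler_pdivrMr // -ler_pdivrMl // mulrC ltW // truncnS_gt.
have [A A0 tauA] := @tau_powR R K 2 k 11 K0 isT.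
exists (c%:R * A * 2 `^ (1 + eps)) => B B1.
have B0 : 0 <= B by apply: le_trans B1.
(* An integer bound above [B]; as [B >= 1], it is at most [2 * B], whence the factor [2 ^ (1 + eps)]
   in the constant. *)
pose N := (Num.truncn B).+1.
have NB : N%:R <= 2 * B.
  have /andP[h _] := truncn_itv B0.
  by rewrite /N -natr1 mulr2n mulrDl !mul1r lerD.
apply: (@le_trans _ _ ((c * N * tau (K * N ^ 2) ^ 11)%N%:R)%:E); last first.
  rewrite lee_fin natrM [(c * N)%N%:R]natrM.
  apply: (@le_trans _ _ (c%:R * N%:R * (A * N%:R `^ eps))).
    rewrite ler_wpM2l ?mulr_ge0 ?ler0n //; apply: le_trans (tauA N isT) _.
    by rewrite ler_wpM2l // ler_powR // ler1n.
  have -> : c%:R * N%:R * (A * N%:R `^ eps) = c%:R * A * N%:R `^ (1 + eps).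
    rewrite powRD ?pnatr_eq0 ?implybT // powRr1 ?ler0n //; ring.
  rewrite -[leRHS]mulrA -powRM //.
  rewrite ler_wpM2l ?mulr_ge0 ?ler0n //.
  by apply: ge0_ler_powR; rewrite ?nnegrE ?mulr_ge0 ?addr_ge0 // ltW.
apply: counting_le.
(* One primitive representative is chosen per point; it determines the point, so counting integral
   quadruples suffices. *)
have [f fP] := choice primitive_repP.
apply: (count_le_inj (f := f) _ _ (H N isT)).
  by move=> P [UP hP]; apply: (openU_int_point B1 UP (fP P) hP).
move=> P P' _ _ e; have [_ [s sE <-]] := fP P; have [_ [s' sE' <-]] := fP P'.
by congr (\pi_wproj _)%qT; apply: val_inj; rewrite /= sE sE' e.
Qed.
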